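(* Let $R(q)=\dfrac{(q;q^5)_\infty(q^4;q^5)_\infty}{(q^2;q^5)_\infty(q^3;q^5)_\infty}$. Define power series \[ \sum\lambda_1(n)q^n=\frac{1}{R^5(q)},\ \sum\lambda_2(n)q^n=\frac{R^5(q)}{R(q^5)},\ \sum\lambda_3(n)q^n=\frac{R(q^2)}{R^2(q)},\ \sum\lambda_4(n)q^n=\frac{1}{R(q)R^2(q^2)}, \] \[ \sum\lambda_5(n)q^n=\frac{1}{R(q)R(q^4)},\ \sum\lambda_6(n)q^n=\frac{1}{R(-q)R(-q^4)},\ \sum\lambda_7(n)q^n=\frac{R(q^4)}{R^4(q)},\ \sum\lambda_8(n)q^n=\frac{R^2(q)}{R^3(q^4)}, \] \[ \sum\lambda_9(n)q^n=\frac{R(q)}{R(q^{16})},\ \sum\lambda_{10}(n)q^n=\frac{R(q^4)}{R^2(q)R(q^2)}, \] (sums over $n\ge0$), and let $\lambda'_j(n)$ denote the coefficient of $q^n$ in the reciprocal of $\sum_n\lambda_j(n)q^n$. Then for all $n\ge0$: (i) $\lambda_1(5n+r)=-\lambda_1'(5n+r-2)$ for $r\in\{3,4\}$; (ii) $\lambda_2(5n)=\lambda_2'(5n)$; (iii) $\lambda_3(5n+r)=-\lambda_3'(5n+r)$ for $r\in\{1,4\}$; (iv) $\lambda_4(5n+r)=-\lambda_4'(5n+r-2)$ for $r\in\{3,4\}$; (v) $\lambda_5(5n+r)=\lambda_5'(5n+r-2)$ for $r\in\{3,4\}$; (vi) $\lambda_6(10n+r)=\lambda_6'(10n+r-2)$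 for $r\in\{5,7\}$; (vii) $\lambda_7(10n+r)=-\lambda_7'(10n+r)$ for $r\in\{1,9\}$; (viii) $\lambda_8(10n+r)=-\lambda_8'(10n+r-4)$ for $r\in\{5,9\}$; (ix) $\lambda_9(10n+r)=\lambda_9'(10n+r-6)$ for $r\in\{7,9\}$; (x) $\lambda_{10}(2n+r)=(-1)^r\lambda_{10}'(2n+r)$ for $r\in\{0,1\}$; (xi) $\lambda_{10}(5n+r)=\lambda_{10}'(5n+r)$ for $r\in\{2,3\}$.
   Context: $(a;q)_\infty=\prod_{j\ge0}(1-aq^j)$, $q$ a formal variable (or complex with $|q|<1$). $R(q)$ is the product form of the Rogers–Ramanujan continued fraction $\frac{1}{1+}\frac{q}{1+}\frac{q^2}{1+}\cdots$; it has constant term $1$, so all the series above and their reciprocals are power series in $q$. *)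

(* Defs.v *)
From HB Require Import structures.
From mathcomp Require Import all_boot all_order all_algebra.
From mathcomp Require Import boolp.

Set Implicit Arguments.
Unset Strict Implicit.
Unset Printing Implicit Defensive.

Import GRing.Theory.
Local Open Scope ring_scope.

(* Formal power series over R in one variable; f n is the coefficient of the
   n-th power of the variable.  The record keeps the Cauchy product apart from
   the pointwise product on functions. *)
Record fps (R : Type) := Fps { fps_coef :> nat -> R }.

Section FpsRing.
Variable R : comNzRingType.
Implicit Types f g h : fps R.

Lemma fpsP f g : (f : nat -> R) =1 g -> f = g.
Proof. by case: f g => [f] [g] /= /funext ->. Qed.

HB.instance Definition _ := gen_eqMixin (fps R).
HB.instance Definition _ := gen_choiceMixin (fps R).

Definition fps_zero : fps R := Fps (fun=> 0).
Definition fps_opp f : fps R := Fps (fun n => - f n).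
Definition fps_add f g : fps R := Fps (fun n => f n + g n).
Definition fps_one : fps R := Fps (fun n => (n == 0%N)%:R).
Definition fps_mul f g : fps R :=
  Fps (fun n => \sum_(i < n.+1) f i * g (n - i)%N).

Fact fps_addA : associative fps_add.
Proof. by move=> f g h; apply: fpsP => n /=; rewrite addrA. Qed.
Fact fps_addC : commutative fps_add.
Proof. by move=> f g; apply: fpsP => n /=; rewrite addrC. Qed.
Fact fps_add0 : left_id fps_zero fps_add.
Proof. by move=> f; apply: fpsP => n /=; rewrite add0r. Qed.
Fact fps_addN : left_inverse fps_zero fps_opp fps_add.
Proof. by move=> f; apply: fpsP => n /=; rewrite addNr. Qed.

HB.instance Definition _ :=
  GRing.isZmodule.Build (fps R) fps_addA fps_addC fps_add0 fps_addN.

Fact fps_mulC : commutative fps_mul.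
Proof.
move=> f g; apply: fpsP => n /=; rewrite (reindex_inj rev_ord_inj) /=.
by apply: eq_bigr => i _; rewrite mulrC subSS subKn // -ltnS.
Qed.

Let agree n f (p : {poly R}) := forall i, (i <= n)%N -> f i = p`_i.

Let agree_poly n f : agree n f (\poly_(i < n.+1) f i).
Proof. by move=> i le_in; rewrite coef_poly ltnS le_in. Qed.

Let agree_mul n f g p q :
  agree n f p -> agree n g q -> agree n (fps_mul f g) (p * q).
Proof.
move=> fp gq i le_in; rewrite coefM /=; apply: eq_bigr => j _.
by rewrite fp ?gq // ?(leq_trans (leq_subr _ _)) // (leq_trans _ le_in) // -ltnS.
Qed.

Fact fps_mulA : associative fps_mul.
Proof.
move=> f g h; apply: fpsP => n.
have [F [G H]] : agree n f (\poly_(i < n.+1) f i) /\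
    agree n g (\poly_(i < n.+1) g i) /\ agree n h (\poly_(i < n.+1) h i).
  by split; last split; apply: agree_poly.
rewrite (agree_mul F (agree_mul G H) (leqnn n)) mulrA.
by rewrite (agree_mul (agree_mul F G) H (leqnn n)).
Qed.
Fact fps_mul1 : left_id fps_one fps_mul.
Proof.
move=> f; apply: fpsP => n /=.
by rewrite big_ord_recl mul1r subn0 big1 ?addr0 // => i _; rewrite mul0r.
Qed.
Fact fps_mulDl : left_distributive fps_mul fps_add.
Proof.
move=> f g h; apply: fpsP => n /=; rewrite -big_split /=.
by apply: eq_bigr => i _; rewrite mulrDl.
Qed.
Fact fps_one_neq0 : fps_one != 0.
Proof.
by apply/eqP => /(congr1 (fun f : fps R => f 0%N)) /eqP; rewrite oner_eq0.
Qed.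

HB.instance Definition _ := GRing.Zmodule_isComNzRing.Build (fps R)
  fps_mulA fps_mulC fps_mul1 fps_mulDl fps_one_neq0.

Definition fpsX : fps R := Fps (fun n => (n == 1%N)%:R).

Lemma fps_coef0 n : (0 : fps R) n = 0. Proof. by []. Qed.
Lemma fps_coef1 n : (1 : fps R) n = (n == 0%N)%:R. Proof. by []. Qed.
Lemma fps_coefN f n : (- f) n = - f n. Proof. by []. Qed.
Lemma fps_coefD f g n : (f + g) n = f n + g n. Proof. by []. Qed.
Lemma fps_coefM f g n : (f * g) n = \sum_(i < n.+1) f i * g (n - i)%N.
Proof. by []. Qed.

Lemma fps_coef0M f g : (f * g) 0%N = f 0%N * g 0%N.
Proof. by rewrite fps_coefM big_ord1. Qed.
Lemma fps_coef0X f n : (f ^+ n) 0%N = f 0%N ^+ n.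
Proof. by elim: n => // n IHn; rewrite !exprS fps_coef0M IHn. Qed.

Lemma fps_exp_valuation f n i : f 0%N = 0 -> (i < n)%N -> (f ^+ n) i = 0.
Proof.
move=> f0; elim: n i => // n IHn i lt_in.
rewrite exprS fps_coefM big_ord_recl f0 mul0r add0r big1 // => j _.
rewrite IHn ?mulr0 // lift0; case: i lt_in j => [|i] lt_in j; first by case: j.
by rewrite subSS (leq_ltn_trans (leq_subr _ _)).
Qed.

End FpsRing.

Section FpsInverse.
Variable R : comUnitRingType.
Implicit Types f g : fps R.

(* The first n coefficients of the inverse of f. *)
Fixpoint fps_inv_seq f (n : nat) : seq R :=
  if n is m.+1 then
    let s := fps_inv_seq f m in
    rcons s ((f 0%N)^-1 * ((m == 0%N)%:R - \sum_(i < m) f (m - i)%N * s`_i))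
  else [::].

Definition fps_unit : pred (fps R) := [pred f : fps R | f 0%N \is a GRing.unit].
Definition fps_inv f : fps R :=
  if f 0%N \is a GRing.unit then Fps (fun n => (fps_inv_seq f n.+1)`_n) else f.

Let size_inv_seq f n : size (fps_inv_seq f n) = n.
Proof. by elim: n => //= n IHn; rewrite size_rcons IHn. Qed.

Let nth_inv_seq f n i :
  (i < n)%N -> (fps_inv_seq f n)`_i = (fps_inv_seq f i.+1)`_i.
Proof.
elim: n => // n IHn; rewrite ltnS leq_eqVlt => /predU1P[-> //| lt_in].
by rewrite [fps_inv_seq f n.+1]/= nth_rcons size_inv_seq lt_in IHn.
Qed.

Fact fps_mulVf : {in fps_unit, left_inverse 1 fps_inv *%R}.
Proof.
move=> f; rewrite inE => Uf; rewrite mulrC; apply: fpsP => n.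
rewrite fps_coefM /fps_inv Uf fps_coef1 (reindex_inj rev_ord_inj) /=.
under eq_bigr => i _ do rewrite subSS subKn -1?ltnS //.
rewrite big_ord_recr /= subnn nth_rcons size_inv_seq ltnn eqxx mulVKr //.
rewrite addrC -addrA [X in _ + X](_ : _ = 0) ?addr0 //.
rewrite addrC; apply/eqP; rewrite subr_eq0; apply/eqP/eq_bigr => i _.
by rewrite (nth_inv_seq f (ltn_ord i)).
Qed.
Fact fps_unitPl f g : g * f = 1 -> f \in fps_unit.
Proof.
move=> /(congr1 (fun h : fps R => h 0%N)); rewrite fps_coef0M fps_coef1 => gf1.
by rewrite inE; apply/unitrPr; exists (g 0%N); rewrite mulrC.
Qed.
Fact fps_inv_out : {in [predC fps_unit], fps_inv =1 id}.
Proof. by move=> f; rewrite !inE /fps_inv => /negbTE->. Qed.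

HB.instance Definition _ := GRing.ComNzRing_hasMulInverse.Build (fps R)
  fps_mulVf fps_unitPl fps_inv_out.

Lemma fps_unitE f : (f \is a GRing.unit) = (f 0%N \is a GRing.unit).
Proof. by []. Qed.

Lemma fps_coef0V f : (f^-1) 0%N = (f 0%N)^-1.
Proof.
rewrite [f^-1]/(fps_inv f) /fps_inv; case: ifPn => [_|/invr_out->//] /=.
by rewrite big_ord0 subr0 mulr1.
Qed.

End FpsInverse.

Section QPochhammer.
Variable R : comNzRingType.
Implicit Types a b : fps R.

Definition qpoch_fin a b (n : nat) : fps R := \prod_(j < n) (1 - a * b ^+ j).

Lemma qpoch_finS a b n :
  qpoch_fin a b n.+1 = qpoch_fin a b n - qpoch_fin a b n * (a * b ^+ n).
Proof. by rewrite /qpoch_fin big_ord_recr /= mulrBr mulr1. Qed.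

(* The infinite product (a; b)_oo.  When b has no constant term, the n-th
   coefficient of the finite products is the same for all those with at least
   n + 1 factors (qpoch_stable); that common value is the n-th coefficient of
   the infinite product. *)
Definition qpoch a b : fps R := Fps (fun n => qpoch_fin a b n.+1 n).

Lemma qpoch_stable a b m n :
  b 0%N = 0 -> (n < m)%N -> qpoch_fin a b m n = qpoch a b n.
Proof.
move=> b0; elim: m => // m IHm; rewrite ltnS leq_eqVlt => /predU1P[-> //|lt_nm].
rewrite qpoch_finS fps_coefD fps_coefN IHm //.
rewrite mulrA fps_coefM big1 ?subr0 // => i _.
by rewrite fps_exp_valuation ?mulr0 // (leq_ltn_trans (leq_subr _ _)).
Qed.

Lemma qpoch_coef0 a b : a 0%N = 0 -> qpoch a b 0%N = 1.
Proof.
move=> a0; rewrite /= /qpoch_fin big_ord1 expr0 mulr1.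
by rewrite fps_coefD fps_coefN a0 subr0 fps_coef1.
Qed.

End QPochhammer.

Notation "''q'" := (fpsX int) (at level 0) : ring_scope.

(* The product form of the Rogers-Ramanujan continued fraction, as a function
   of its argument x, a series without constant term: R(q), R(q ^+ k) and
   R(- q ^+ k) are the values at x = 'q, 'q ^+ k and - 'q ^+ k. *)
Definition RR (x : fps int) : fps int :=
  (qpoch x (x ^+ 5) * qpoch (x ^+ 4) (x ^+ 5)) /
  (qpoch (x ^+ 2) (x ^+ 5) * qpoch (x ^+ 3) (x ^+ 5)).

Lemma RR_coef0 (x : fps int) : x 0%N = 0 -> RR x 0%N = 1.
Proof.
move=> x0; rewrite /RR fps_coef0M fps_coef0V !fps_coef0M.
by rewrite !qpoch_coef0 ?fps_coef0X ?x0 ?expr0n // !mulr1 invr1.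
Qed.

Lemma RR_unit (x : fps int) : x 0%N = 0 -> RR x \is a GRing.unit.
Proof. by move=> x0; rewrite fps_unitE RR_coef0 ?unitr1. Qed.

Definition lambda1 : fps int := 1 / RR 'q ^+ 5.
Definition lambda2 : fps int := RR 'q ^+ 5 / RR ('q ^+ 5).
Definition lambda3 : fps int := RR ('q ^+ 2) / RR 'q ^+ 2.
Definition lambda4 : fps int := 1 / (RR 'q * RR ('q ^+ 2) ^+ 2).
Definition lambda5 : fps int := 1 / (RR 'q * RR ('q ^+ 4)).
Definition lambda6 : fps int := 1 / (RR (- 'q) * RR (- 'q ^+ 4)).
Definition lambda7 : fps int := RR ('q ^+ 4) / RR 'q ^+ 4.
Definition lambda8 : fps int := RR 'q ^+ 2 / RR ('q ^+ 4) ^+ 3.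
Definition lambda9 : fps int := RR 'q / RR ('q ^+ 16).
Definition lambda10 : fps int :=
  RR ('q ^+ 4) / (RR 'q ^+ 2 * RR ('q ^+ 2)).

(* Main.v *)
(* For a suitable sign and exponent s, the series F = lambda_j +- q^s lambda_j^-1 or,
   in (vi)-(ix), its odd part, is a combination of series q^k T(q) G(q^5), where T is
   a theta series, the sum of the +-q^(m n(n-1)/2 + a n) over the integers n.  Modulo
   5 these exponents avoid some residues, in which F then has no coefficients; and
   (x) holds because lambda_10 = R(-q) / R(q).

   By the Jacobi triple product all theta series are products of (q^a; q^m)_oo, like
   R itself, and an identity between such products, or the fact that one is a series
   in q^5, is checked on the exponents of finitely many (q^r; q^M)_oo.  The additive
   identities come from cutting double sums over Z^2 into cosets of sublattices; for
   instance R(q^2) / R(q)^2 = (X + qY) / (X - qY) for two theta products X and Y.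

   For (i) and (ii) one uses R(q)^5 = R(q^5) B / A, where A and B are polynomials in
   v = q R(q^5): the 5-dissection of (q; q)_oo and its norm over the fifth roots of
   unity give a quadratic equation for R(q)^5. *)
Require Import Defs.
From HB Require Import structures.
From mathcomp Require Import all_boot all_order all_algebra all_field.
From mathcomp Require Import boolp classical_sets functions fsbigop.
From mathcomp Require Import zify ring.
Set Implicit Arguments.
Unset Strict Implicit.
Unset Printing Implicit Defensive.
Import Order.TTheory GRing.Theory Num.Theory.
Local Open Scope ring_scope.

(** * Formal power series *)

(** Parts (vi)-(xi) rest on the product identity R(q) R(-q) = R(q^4) / R(q^2). Up to even series it
    turns lambda_j and its inverse into the same power k of R(q) and of R(-q), in one order or the
    other. Hence the odd part of F, and in (xi) F itself, has the factor R(q)^k - R(-q)^k. This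
    factor is computed from one theta product that is split into its even and odd parts.

    In (iii)-(v) the obstacle is a sum of squares X^2 + q^2 Y^2 (in (v) with q^2 for q), which is
    not visibly a product. It is rewritten as a difference of squares with (q; q)_oo (q^5; q^5)_oo
    as one factor; the other factor is a sum of two products, and each of them contributes one theta
    series T.

    In (i) and (ii) the integers have no fifth roots of unity: the norm is computed over [algC] and
    the result, which has integer coefficients, is carried back. *)

Section Coefficients.
Variable R : comNzRingType.
Implicit Types f g h a b : fps R.

Lemma fps_coefXnM f k n :
  (fpsX R ^+ k * f) n = if (n < k)%N then 0 else f (n - k)%N.
Proof.
elim: k n => [|k IHk] n; first by rewrite expr0 mul1r subn0.
rewrite exprS -mulrA fps_coefM; case: n => [|n].
  by rewrite big_ord1 /= mul0r.
rewrite big_ord_recl mul0r add0r big_ord_recl big1 => [|i _].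
  by rewrite addr0 mul1r lift0 subSS subn0 IHk ltnS.
by rewrite mul0r.
Qed.

Lemma fps_coefXn k n : (fpsX R ^+ k) n = (n == k)%:R.
Proof.
rewrite -[_ ^+ k]mulr1 fps_coefXnM fps_coef1 subn_eq0.
by case: ltngtP => //=; rewrite ?eqxx.
Qed.

Lemma fpsXn_lreg k f g : fpsX R ^+ k * f = fpsX R ^+ k * g -> f = g.
Proof.
move=> eq_fg; apply: fpsP => n.
move/(congr1 (fun h : fps R => h (k + n)%N)): eq_fg.
by rewrite !fps_coefXnM ltnNge leq_addr /= addKn.
Qed.

Lemma fps_coef_natl k f n : (k%:R * f) n = k%:R * f n.
Proof.
elim: k => [|k IHk]; first by rewrite !mul0r.
by rewrite -addn1 !natrD !mulrDl !mul1r fps_coefD IHk.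
Qed.

Lemma fps_coef_intl (k : int) f n : (k%:~R * f) n = k%:~R * f n.
Proof.
case: k => k; first exact: fps_coef_natl.
by rewrite NegzE !rmorphN !mulNr fps_coefN; congr (- _); apply: fps_coef_natl.
Qed.

Lemma fps_coef_sum (I : Type) (r : seq I) (P : pred I) (F : I -> fps R) n :
  (\sum_(i <- r | P i) F i) n = \sum_(i <- r | P i) F i n.
Proof. exact: (big_morph (fun f : fps R => f n) (fun f g => erefl) erefl). Qed.

(** Congruence modulo q^(N+1). Identities between infinite products are proved modulo every such
    power, where [qpoch] can be replaced with a finite product of any sufficient length. *)
Definition fps_eqmod N f g := forall i, (i <= N)%N -> f i = g i.

Lemma fps_eqmodM N f f' g g' :
  fps_eqmod N f f' -> fps_eqmod N g g' -> fps_eqmod N (f * g) (f' * g').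
Proof.
move=> ff gg i le_iN; rewrite !fps_coefM; apply: eq_bigr => j _.
have le_jN: (j <= N)%N by apply: leq_trans le_iN; rewrite -ltnS.
by rewrite ff // gg // (leq_trans _ le_iN) ?leq_subr.
Qed.

Lemma fps_eqmod_prod N n (F G : 'I_n -> fps R) :
  (forall i, fps_eqmod N (F i) (G i)) ->
  fps_eqmod N (\prod_i F i) (\prod_i G i).
Proof. by move=> FG; elim/big_ind2: _ => // f f' g g'; apply: fps_eqmodM. Qed.

Lemma fps_eqmod_eq f g : (forall N, fps_eqmod N f g) -> f = g.
Proof. by move=> fg; apply: fpsP => n; apply: (fg n). Qed.

Lemma qpoch_eqmod a b N M :
  b 0%N = 0 -> (N < M)%N -> fps_eqmod N (qpoch a b) (qpoch_fin a b M).
Proof.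
by move=> b0 lt_NM i le_iN; rewrite qpoch_stable // (leq_ltn_trans le_iN).
Qed.

(** The substitution of c q for q; below, c is -1 or a power of a fifth root of unity. *)
Definition fps_scale (c : R) f : fps R := Fps (fun n => c ^+ n * f n).

Lemma fps_scale_is_additive c : zmod_morphism (fps_scale c).
Proof. by move=> f g; apply: fpsP => n /=; rewrite mulrBr. Qed.
Lemma fps_scale_is_multiplicative c : monoid_morphism (fps_scale c).
Proof.
split=> [|f g]; apply: fpsP => n.
  by case: n => [|n] /=; rewrite ?mulr1 ?mulr0.
rewrite [LHS]/= !fps_coefM mulr_sumr; apply: eq_bigr => i _ /=.
have le_in: (i <= n)%N by rewrite -ltnS.
have -> : c ^+ n = c ^+ i * c ^+ (n - i) by rewrite -exprD subnKC.
by ring.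
Qed.
HB.instance Definition _ c := GRing.isZmodMorphism.Build (fps R) (fps R)
  (fps_scale c) (fps_scale_is_additive c).
HB.instance Definition _ c := GRing.isMonoidMorphism.Build (fps R) (fps R)
  (fps_scale c) (fps_scale_is_multiplicative c).

(* [fps_dilate k f] is [f(q^(k+1))]. *)
Definition fps_dilate k f : fps R :=
  Fps (fun n => if (k.+1 %| n)%N then f (n %/ k.+1)%N else 0).

Lemma fps_dilate_is_additive k : zmod_morphism (fps_dilate k).
Proof. by move=> f g; apply: fpsP => n /=; case: ifP => //; rewrite subr0. Qed.
Lemma fps_dilate_is_multiplicative k : monoid_morphism (fps_dilate k).
Proof.
split=> [|f g]; apply: fpsP => n.
  rewrite /=; case: ifP => [/dvdnP[j ->]|]; last by case: n.
  by rewrite mulnK // muln_eq0 orbF.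
rewrite [LHS]/= !fps_coefM; case: ifP => [/dvdnP[j ->]|n_k].
  rewrite mulnK // [RHS](bigID (fun i : 'I_ _ => k.+1 %| i)%N) /=.
  rewrite [X in _ + X]big1 ?addr0 => [|i /negPf->]; last by rewrite mul0r.
  have lt_h (i : 'I_j.+1) : (i * k.+1 < (j * k.+1).+1)%N.
    by rewrite ltnS leq_mul2r -ltnS ltn_ord orbT.
  rewrite [RHS](reindex_onto (fun i => Ordinal (lt_h i))
                             (fun i => inord (i %/ k.+1))) /=.
    apply: eq_big => [i|i _].
      by rewrite dvdn_mull // mulnK // inord_val eqxx.
    by rewrite -mulnBl !dvdn_mull // !mulnK.
  move=> i ki; apply/val_inj => /=; rewrite inordK ?divnK //.
  by rewrite ltnS leq_divLR // -ltnS ltn_ord.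
rewrite big1 // => i _ /=; case: ifP => ki; last by rewrite mul0r.
case: ifP => kni; last by rewrite mulr0.
have le_in: (i <= n)%N by rewrite -ltnS.
by rewrite -(subnKC le_in) dvdn_add in n_k.
Qed.
HB.instance Definition _ k := GRing.isZmodMorphism.Build (fps R) (fps R)
  (fps_dilate k) (fps_dilate_is_additive k).
HB.instance Definition _ k := GRing.isMonoidMorphism.Build (fps R) (fps R)
  (fps_dilate k) (fps_dilate_is_multiplicative k).

Lemma fps_dilate_inj k : injective (fps_dilate k).
Proof.
move=> f g eq_fg; apply: fpsP => n.
move/(congr1 (fun h : fps R => h (n * k.+1)%N)): eq_fg.
by rewrite /= dvdn_mull // mulnK.
Qed.

Lemma fps_dilateX k : fps_dilate k (fpsX R) = fpsX R ^+ k.+1.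
Proof.
apply: fpsP => n; rewrite fps_coefXn /=; case: ifP => [/dvdnP[j ->]|].
  by rewrite mulnK // -{2}[k.+1]mul1n eqn_mul2r.
by case: eqP => // ->; rewrite dvdnn.
Qed.

Lemma qpoch_fin_rmorph (S : comNzRingType) (phi : {rmorphism fps R -> fps S})
    a b n : phi (qpoch_fin a b n) = qpoch_fin (phi a) (phi b) n.
Proof.
rewrite /qpoch_fin rmorph_prod; apply: eq_bigr => i _.
by rewrite rmorphB rmorph1 rmorphM rmorphXn.
Qed.

Lemma qpoch_scale c a b :
  fps_scale c (qpoch a b) = qpoch (fps_scale c a) (fps_scale c b).
Proof. by apply: fpsP => n /=; rewrite -qpoch_fin_rmorph. Qed.

Lemma qpoch_dilate k a b : b 0%N = 0 ->
  fps_dilate k (qpoch a b) = qpoch (fps_dilate k a) (fps_dilate k b).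
Proof.
move=> b0; apply: fpsP => n; rewrite [RHS]/= -qpoch_fin_rmorph /=.
by case: ifP => // kn; rewrite [RHS]qpoch_stable ?ltnS ?leq_div.
Qed.

(** The factors whose index is i modulo k form a product of base b^k that starts at a b^i. The left
    side is cut after k (N + 1) factors, so that every class keeps exactly N + 1 of them. *)
Lemma qpochM a b k : b 0%N = 0 -> (0 < k)%N ->
  qpoch a b = \prod_(i < k) qpoch (a * b ^+ i) (b ^+ k).
Proof.
move=> b0 k0; apply: fps_eqmod_eq => N i le_iN.
have bk0: (b ^+ k) 0%N = 0 by rewrite fps_coef0X b0 expr0n -leqn0 leqNgt k0.
have kN: (N < k * N.+1)%N by rewrite -{1}[N.+1]mul1n leq_mul2r k0 orbT.
rewrite (qpoch_eqmod _ _ kN) //.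
rewrite (fps_eqmod_prod (fun j => qpoch_eqmod _ bk0 (ltnSn N))) //.
congr (fps_coef _ i); rewrite {kN}/qpoch_fin exchange_big /=.
elim: N.+1 => [|M IHM]; first by rewrite muln0 !big_ord0.
rewrite mulnS addnC big_split_ord IHM [RHS]big_ord_recr; congr (_ * _).
by apply: eq_bigr => j _; rewrite -exprM -mulrA -exprD /= [(j + _)%N]addnC.
Qed.

Lemma qpoch_recl a b : b 0%N = 0 -> qpoch a b = (1 - a) * qpoch (a * b) b.
Proof.
move=> b0; apply: fps_eqmod_eq => N i le_iN.
rewrite (@qpoch_eqmod a b N N.+2 b0 _ i) //.
rewrite (fps_eqmodM (fun _ _ => erefl) (qpoch_eqmod (a * b) b0 (ltnSn N))) //.
rewrite /qpoch_fin big_ord_recl expr0 mulr1; congr (fps_coef (_ * _) i).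
by apply: eq_bigr => j _; rewrite lift0 exprS mulrA.
Qed.

Lemma qpoch_sqr a b : b 0%N = 0 ->
  qpoch a b * qpoch (- a) b = qpoch (a ^+ 2) (b ^+ 2).
Proof.
move=> b0; apply: fps_eqmod_eq => N i le_iN.
have b20: (b ^+ 2) 0%N = 0 by rewrite fps_coef0X b0 expr0n.
rewrite (fps_eqmodM (qpoch_eqmod a b0 (ltnSn N))
                    (qpoch_eqmod (- a) b0 (ltnSn N))) //.
rewrite (qpoch_eqmod _ b20 (ltnSn N)) //; congr (fps_coef _ i).
rewrite /qpoch_fin -big_split; apply: eq_bigr => j _ /=.
by rewrite -!exprM mulnC exprM; ring.
Qed.

End Coefficients.

(** The cyclotomic equation stands for the primitivity of w: it makes sense in every commutative
    ring and is preserved by ring morphisms, in particular by [fps_const]. *)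
Lemma fifth_root_exp5 (A : comNzRingType) (w : A) :
  1 + w + w ^+ 2 + w ^+ 3 + w ^+ 4 = 0 -> w ^+ 5 = 1.
Proof.
move=> w0; apply/eqP; rewrite -subr_eq0; apply/eqP.
by transitivity ((w - 1) * (1 + w + w ^+ 2 + w ^+ 3 + w ^+ 4)); [ring | rewrite w0 mulr0].
Qed.

(** * Constant series and products over the fifth roots of unity *)

Section Constants.
Variables (F : comNzRingType).
Implicit Types (c d : F) (f : fps F).

Definition fps_const c : fps F := Fps (fun n => if n == 0%N then c else 0).

Lemma fps_coef_constM c f n : (fps_const c * f) n = c * f n.
Proof.
rewrite fps_coefM big_ord_recl big1 ?addr0 ?subn0 //= => i _.
by rewrite mul0r.
Qed.

Lemma fps_const_is_additive : zmod_morphism fps_const.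
Proof. by move=> c d; apply: fpsP => -[|n] /=; rewrite ?subr0. Qed.
Lemma fps_const_is_multiplicative : monoid_morphism fps_const.
Proof.
split=> [|c d]; apply: fpsP => n; first by case: n.
by rewrite fps_coef_constM; case: n => [|n] //=; rewrite mulr0.
Qed.
HB.instance Definition _ := GRing.isZmodMorphism.Build F (fps F)
  fps_const fps_const_is_additive.
HB.instance Definition _ := GRing.isMonoidMorphism.Build F (fps F)
  fps_const fps_const_is_multiplicative.

Lemma fps_scale_X c : fps_scale c (fpsX F) = fps_const c * fpsX F.
Proof.
apply: fpsP => n; rewrite fps_coef_constM /=.
by case: n => [|[|n]] /=; rewrite ?mulr0 ?expr1.
Qed.

Lemma prod_fifth_roots (w y : fps F) : 1 + w + w ^+ 2 + w ^+ 3 + w ^+ 4 = 0 ->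
  \prod_(j < 5) (1 - w ^+ j * y) = 1 - y ^+ 5.
Proof.
move=> w0; have w5 := fifth_root_exp5 w0.
have w4 : w ^+ 4 = - (1 + w + w ^+ 2 + w ^+ 3).
  by apply/eqP; rewrite -addr_eq0 addrC; apply/eqP; rewrite -w0; ring.
rewrite !big_ord_recl big_ord0 /= !mulr1 /bump /=.
(* Pairing w^j with w^(5-j) gives the factors 1 - a y + y^2 and 1 - b y + y^2, where a and b are the
   roots of x^2 + x - 1. *)
set a := w + w ^+ 4; set b := w ^+ 2 + w ^+ 3.
have sab : b = - 1 - a by rewrite /a /b w4; ring.
have pab : a ^+ 2 = 1 - a.
  have : a * b = - 1.
    transitivity (w ^+ 3 + w ^+ 4 + w ^+ 5 * (w + w ^+ 2)); first by rewrite /a /b; ring.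
    by rewrite w5 w4; ring.
  by rewrite sab => e; transitivity (- (a * (- 1 - a)) - a); [ring | rewrite e; ring].
transitivity ((1 - y) * ((1 - a * y + w ^+ 5 * y ^+ 2) * (1 - b * y + w ^+ 5 * y ^+ 2))).
  by rewrite /a /b; ring.
rewrite w5 sab; transitivity ((1 - y) * (1 + y + y ^+ 2 * (2%:R - a - a ^+ 2) + y ^+ 3 + y ^+ 4));
  first by ring.
by rewrite pab; ring.
Qed.

Lemma qpoch_fifth_roots (w a b : fps F) : b 0%N = 0 ->
  1 + w + w ^+ 2 + w ^+ 3 + w ^+ 4 = 0 ->
  \prod_(j < 5) qpoch (w ^+ j * a) b = qpoch (a ^+ 5) (b ^+ 5).
Proof.
move=> b0 w0; apply: fps_eqmod_eq => N i le_iN.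
have b50 : (b ^+ 5) 0%N = 0 by rewrite fps_coef0X b0 expr0n.
rewrite (fps_eqmod_prod (fun j : 'I_5 => qpoch_eqmod (w ^+ j * a) b0 (ltnSn N)) le_iN).
rewrite (qpoch_eqmod _ b50 (ltnSn N) le_iN); congr (fps_coef _ i).
rewrite /qpoch_fin exchange_big; apply: eq_bigr => k _ /=.
rewrite -exprM mulnC exprM -exprMn -(prod_fifth_roots _ w0).
by apply: eq_bigr => j _; rewrite mulrA.
Qed.

(** With a = - (w + w^4), a root of x^2 = x + 1, the polynomial 1 - x - x^2 is (1 - a x) (1 - (1 -
    a) x), and [prod_fifth_roots] applies to both factors. The coefficient 11 is the Lucas number
    a^5 + (1 - a)^5; the last sign is that of (a (1 - a))^5 = -1. *)
Lemma prod_golden (w v : fps F) : 1 + w + w ^+ 2 + w ^+ 3 + w ^+ 4 = 0 ->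
  \prod_(j < 5) (1 - w ^+ j * v - (w ^+ j * v) ^+ 2) = 1 - 11%:R * v ^+ 5 - v ^+ 10.
Proof.
move=> w0; have w5 := fifth_root_exp5 w0.
have w4 : w ^+ 4 = - (1 + w + w ^+ 2 + w ^+ 3).
  by apply/eqP; rewrite -addr_eq0 addrC; apply/eqP; rewrite -w0; ring.
pose a := - (w + w ^+ 4).
have pab : a ^+ 2 = 1 + a.
  have : - a * (w ^+ 2 + w ^+ 3) = - 1.
    transitivity (w ^+ 3 + w ^+ 4 + w ^+ 5 * (w + w ^+ 2)); first by rewrite /a; ring.
    by rewrite w5 w4; ring.
  have -> : w ^+ 2 + w ^+ 3 = a - 1 by rewrite /a w4; ring.
  by move=> e; transitivity (a - (- a * (a - 1))); [ring | rewrite e; ring].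
transitivity (\prod_(j < 5) (1 - w ^+ j * (a * v)) * \prod_(j < 5) (1 - w ^+ j * ((1 - a) * v))).
  rewrite -big_split; apply: eq_bigr => j _ /=.
  transitivity (1 - w ^+ j * v + (a - a ^+ 2) * (w ^+ j * v) ^+ 2); last by ring.
  by rewrite pab; ring.
rewrite !(prod_fifth_roots _ w0).
have golden5 (x : fps F) : x ^+ 2 = 1 + x -> x ^+ 5 = 5%:R * x + 3%:R.
  move=> x2; transitivity (x ^+ 2 * x ^+ 2 * x); first by ring.
  rewrite x2; transitivity (x + 2%:R * x ^+ 2 + x ^+ 2 * x); first by ring.
  rewrite x2; transitivity (2%:R + 4%:R * x + x ^+ 2); first by ring.
  by rewrite x2; ring.
have a5 := golden5 a pab.
have b5 : (1 - a) ^+ 5 = 5%:R * (1 - a) + 3%:R.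
  apply: golden5; transitivity (1 - 2%:R * a + a ^+ 2); first by ring.
  by rewrite pab; ring.
rewrite !exprMn a5 b5.
transitivity (1 - 11%:R * v ^+ 5 + (24%:R + 25%:R * a - 25%:R * a ^+ 2) * v ^+ 10);
  first by ring.
by rewrite pab; ring.
Qed.

End Constants.

(** * Change of the coefficient ring *)

Section MapFps.
Variables (A B : comNzRingType) (phi : {rmorphism A -> B}).

Definition fps_map (f : fps A) : fps B := Fps (fun n => phi (f n)).

Lemma fps_map_is_additive : zmod_morphism fps_map.
Proof. by move=> f g; apply: fpsP => n; apply: (rmorphB phi). Qed.
Lemma fps_map_is_multiplicative : monoid_morphism fps_map.
Proof.
split=> [|f g]; apply: fpsP => n.
  by case: n => [|n]; [apply: (rmorph1 phi) | apply: (rmorph0 phi)].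
apply: etrans (rmorph_sum phi _ _ _) _.
by apply: eq_bigr => i _; apply: (rmorphM phi).
Qed.
HB.instance Definition _ := GRing.isZmodMorphism.Build (fps A) (fps B)
  fps_map fps_map_is_additive.
HB.instance Definition _ := GRing.isMonoidMorphism.Build (fps A) (fps B)
  fps_map fps_map_is_multiplicative.

Lemma fps_mapX : fps_map (fpsX A) = fpsX B.
Proof. by apply: fpsP => n; apply: (rmorph_nat phi). Qed.

Lemma qpoch_map a b : fps_map (qpoch a b) = qpoch (fps_map a) (fps_map b).
Proof.
apply: fpsP => n.
exact: (congr1 (fun f : fps B => f n) (qpoch_fin_rmorph fps_map a b n.+1)).
Qed.

End MapFps.

Lemma fps_map_intr_inj : injective (fps_map (intr : {rmorphism int -> algC})).
Proof.
move=> f g e; apply: fpsP => n; apply: (@intr_inj algC).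
exact: (congr1 (fun h : fps algC => h n) e).
Qed.

Lemma fps_scale_dilate (F : comNzRingType) (c : F) k f : c ^+ k.+1 = 1 ->
  fps_scale c (fps_dilate k f) = fps_dilate k f.
Proof.
move=> ck; apply: fpsP => n /=; case: ifP => [/dvdnP[j ->]|]; last by rewrite mulr0.
by rewrite mulnC exprM ck expr1n mul1r.
Qed.

Lemma fps_map_dilate (A B : comNzRingType) (phi : {rmorphism A -> B}) k f :
  fps_map phi (fps_dilate k f) = fps_dilate k (fps_map phi f).
Proof. by apply: fpsP => n /=; case: ifP => //; rewrite rmorph0. Qed.

Lemma algC_fifth_root : exists z : algC, 1 + z + z ^+ 2 + z ^+ 3 + z ^+ 4 = 0.
Proof.
have [z z_prim] := @C_prim_root_exists 5 isT.
exists z; have z1 : z - 1 != 0.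
  rewrite subr_eq0; apply/negP => /eqP z1.
  by have := prim_order_dvd z_prim 1; rewrite expr1 z1 eqxx.
apply: (mulfI z1); rewrite mulr0.
transitivity (z ^+ 5 - 1); first by ring.
by rewrite (prim_expr_order z_prim) subrr.
Qed.

(** * Sums over lattices *)

Section LatticeSums.

(** The series of the c(i) q^(e(i)). A finitely supported sum has the default value 0 when the
    support is infinite, so the definition is meaningful only for finite fibres of e; [coercive]
    provides them. *)
Definition lsum (I : choiceType) (e c : I -> int) : fps int :=
  Fps (fun N => \sum_(i \in [set i | e i = N%:Z]%classic) c i).

(** Finiteness is asked of sublevel sets rather than of fibres: together with nonnegativity, this
    passes to sums of two exponents ([coercive_pair]), hence to products of series. *)
Definition coercive (I : choiceType) (e : I -> int) :=
  (forall i, 0 <= e i) /\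
  (forall N : nat, exists s : seq I, forall i, e i <= N%:Z -> i \in s).

Lemma lsumE (I : choiceType) (e c : I -> int) (N : nat) (s : seq I) :
  uniq s -> (forall i, e i = N%:Z -> i \in s) ->
  lsum e c N = \sum_(i <- s | e i == N%:Z) c i.
Proof.
move=> s_uniq es; rewrite bigfs // => [|i /eqP/es->//].
by apply: eq_fsbigl; apply/seteqP; split=> i /= /eqP.
Qed.

Lemma coercive_seq (I : choiceType) (e : I -> int) (N : nat) : coercive e ->
  exists s : seq I, uniq s /\ forall i, e i <= N%:Z -> i \in s.
Proof.
case=> _ /(_ N)[s es]; exists (undup s); split; first exact: undup_uniq.
by move=> i /es; rewrite mem_undup.
Qed.

Lemma lsum_bij (I J : choiceType) (h : J -> I) (e c : I -> int)
    (e' c' : J -> int) :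
  injective h -> (forall i, exists j, h j = i) ->
  (forall j, e (h j) = e' j) -> (forall j, c (h j) = c' j) ->
  lsum e c = lsum e' c'.
Proof.
move=> h_inj h_surj ee cc; apply: fpsP => N /=.
rewrite (reindex_fsbig h [set j | e' j = N%:Z]%classic); last first.
  split=> [j /=|x y _ _ /h_inj//|i /= eiN]; first by rewrite ee.
  by case: (h_surj i) => j hj; exists j => //=; rewrite -ee hj.
by apply: eq_fsbigr => j _; rewrite cc.
Qed.

Lemma lsum_ext (I : choiceType) (e c e' c' : I -> int) :
  e =1 e' -> c =1 c' -> lsum e c = lsum e' c'.
Proof. by move=> /funext-> /funext->. Qed.

Lemma lsumX (I : choiceType) (e c : I -> int) (k : nat) (a : int) : coercive e ->
  lsum (fun i => k%:Z + e i) (fun i => a * c i) =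
  a%:~R * ('q ^+ k * lsum e c).
Proof.
move=> ep; apply: fpsP => N; have [s [s_uniq es]] := coercive_seq N ep.
have e0 := ep.1.
rewrite fps_coef_intl fps_coefXnM (lsumE _ s_uniq) => [|i]; last first.
  by move=> eiN; apply: es; rewrite -eiN lerDr.
rewrite intz -mulr_sumr; congr (_ * _); case: ltnP => ltNk.
  by rewrite big1 // => i; have := e0 i; lia.
rewrite (lsumE _ s_uniq) => [|i eiN]; last by apply: es; lia.
by apply: eq_bigl => i; have := e0 i; lia.
Qed.

Lemma coercive_pair (I J : choiceType) (e : I -> int) (e' : J -> int) :
  coercive e -> coercive e' -> coercive (fun x : I * J => e x.1 + e' x.2).
Proof.
move=> [e0 es] [e'0 e's]; split=> [x|N]; first by rewrite addr_ge0.
case: (es N) (e's N) => s sP [s' s'P]; exists [seq (x, y) | x <- s, y <- s'].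
move=> [x y] /= le_N; apply/allpairsP; exists (x, y) => /=.
by split=> //; [apply: sP | apply: s'P]; have := e0 x; have := e'0 y; lia.
Qed.

Lemma lsumM (I J : choiceType) (e c : I -> int) (e' c' : J -> int) :
  coercive e -> coercive e' ->
  lsum e c * lsum e' c' =
  lsum (fun x : I * J => e x.1 + e' x.2) (fun x => c x.1 * c' x.2).
Proof.
move=> ep e'p; apply: fpsP => N.
have [s [s_uniq es]] := coercive_seq N ep.
have [s' [s'_uniq e's]] := coercive_seq N e'p.
have e0 := ep.1; have e'0 := e'p.1.
rewrite (@lsumE _ _ _ _ [seq (x, y) | x <- s, y <- s']); first last.
- move=> [x y] /= eN; apply/allpairsP; exists (x, y) => /=.
  by split=> //; [apply: es | apply: e's]; have := e0 x; have := e'0 y; lia.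
- by apply: allpairs_uniq => // -[x y] [x' y'] _ _ /= [-> ->].
rewrite big_mkcond big_allpairs fps_coefM.
transitivity (\sum_(i < N.+1) \sum_(x <- s) \sum_(y <- s')
    if (e x == i%:Z) && (e' y == (N - i)%N%:Z) then c x * c' y else 0).
  apply: eq_bigr => i _; have lt_iN := ltn_ord i.
  rewrite (lsumE _ s_uniq) => [|x exi]; last by apply: es; lia.
  rewrite (lsumE _ s'_uniq) => [|x exi]; last by apply: e's; lia.
  rewrite big_mkcond mulr_suml; apply: eq_bigr => x _.
  case: eqP => _ /=; last by rewrite mul0r big1.
  by rewrite big_mkcond mulr_sumr; apply: eq_bigr => y _; case: ifP; rewrite ?mulr0.
rewrite exchange_big; apply: eq_bigr => x _.
rewrite exchange_big; apply: eq_bigr => y _ /=.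
have ex0 := e0 x; have ey0 := e'0 y.
case: eqP => [eN|neN].
  have ltx : (`|e x| < N.+1)%N by lia.
  rewrite (bigD1 (Ordinal ltx)) //= big1 => [|i /eqP nei].
    by rewrite addr0 ifT //; lia.
  rewrite ifF //; apply/negP => /andP[/eqP exi _]; apply: nei.
  by apply/val_inj => /=; lia.
by rewrite big1 // => i _; rewrite ifF //; have := ltn_ord i; lia.
Qed.

Lemma lsum_ord k (J : choiceType) (e c : 'I_k * J -> int) : coercive e ->
  lsum e c = \sum_(r < k) lsum (fun j => e (r, j)) (fun j => c (r, j)).
Proof.
move=> ep; apply: fpsP => N; have [s [s_uniq es]] := coercive_seq N ep.
pose t := undup [seq x.2 | x <- s].
have t_uniq : uniq t by apply: undup_uniq.
have et x : e x = N%:Z -> x.2 \in t.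
  by move=> ex; rewrite mem_undup; apply/mapP; exists x => //; apply: es; lia.
rewrite fps_coef_sum (@lsumE _ _ _ _ [seq (r, j) | r <- enum 'I_k, j <- t]).
- rewrite big_mkcond big_allpairs big_enum; apply: eq_bigr => r _ /=.
  rewrite -[RHS]/(lsum (fun j => e (r, j)) (fun j => c (r, j)) N).
  by rewrite (lsumE _ t_uniq) => [|j /et//]; rewrite [RHS]big_mkcond.
- apply: allpairs_uniq => // [|-[x y] [x' y'] _ _ /= [-> ->]//].
  exact: enum_uniq.
- move=> [r j] ex; apply/allpairsP; exists (r, j) => /=.
  by rewrite mem_enum (et _ ex).
Qed.

Lemma lsum_cover k (I J : choiceType) (h : 'I_k -> J -> I) (e c : I -> int) :
  (forall r r' j j', h r j = h r' j' -> r = r' /\ j = j') ->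
  (forall i, exists r j, h r j = i) -> coercive e ->
  lsum e c = \sum_(r < k) lsum (e \o h r)%FUN (c \o h r)%FUN.
Proof.
move=> h_inj h_surj ep; pose H (x : 'I_k * J) := h x.1 x.2.
have H_inj : injective H by move=> [r j] [r' j'] /h_inj /= [-> ->].
have H_surj i : exists x, H x = i.
  by case: (h_surj i) => r [j hrj]; exists (r, j).
rewrite (@lsum_bij _ _ H e c (e \o H)%FUN (c \o H)%FUN) // lsum_ord //.
split=> [x|N]; first exact: ep.1.
have [g gK] := choice H_surj; have [s es] := ep.2 N.
by exists (map g s) => x /es xs; apply/mapP; exists (H x) => //; apply: H_inj.
Qed.

End LatticeSums.

(** * The Jacobi triple product *)

Section JacobiTripleProduct.

Section Gauss.
Variable p : fps int.

(** The Gaussian binomial coefficient of base p, defined by a Pascal rule because this needs no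
    division. *)
Fixpoint gbin (N k : nat) : fps int :=
  match N, k with
  | _, 0%N => 1
  | 0%N, _.+1 => 0
  | N.+1, k.+1 => gbin N k.+1 + p ^+ (N - k) * gbin N k
  end.

Lemma gbin0 N : gbin N 0 = 1. Proof. by case: N. Qed.

Lemma gbinS N k : gbin N.+1 k.+1 = gbin N k.+1 + p ^+ (N - k) * gbin N k.
Proof. by []. Qed.

Lemma gbin_small N k : (N < k)%N -> gbin N k = 0.
Proof.
elim: N k => [|N IHN] [|k] // lt_Nk.
by rewrite gbinS !IHN ?mulr0 ?addr0 //; lia.
Qed.

Lemma gbin_fact N k : (k <= N)%N ->
  gbin N k * (qpoch_fin p p k * qpoch_fin p p (N - k)) = qpoch_fin p p N.
Proof.
elim: N k => [|N IHN] [|k] le_kN.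
- by rewrite /qpoch_fin !big_ord0 !mulr1.
- by [].
- by rewrite gbin0 subn0 /qpoch_fin big_ord0 !mul1r.
rewrite gbinS subSS; have IHk := IHN k le_kN.
have fS n : qpoch_fin p p n.+1 = qpoch_fin p p n * (1 - p ^+ n.+1).
  by rewrite qpoch_finS mulrBr mulr1 exprS.
have pE : p ^+ N.+1 = p ^+ k.+1 * p ^+ (N - k).
  by rewrite -exprD addSn subnKC.
rewrite !fS pE.
move: le_kN; rewrite ltnS leq_eqVlt => /predU1P[eq_kN|lt_kN].
  subst k; rewrite subnn expr0 gbin_small // add0r mulr1 mul1r.
  by move: IHk; rewrite subnn => IHk; rewrite -[in RHS]IHk; ring.
have := IHN k.+1 lt_kN; rewrite -(subnSK lt_kN) !fS (subnSK lt_kN) => IHk1.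
move: IHk; rewrite -(subnSK lt_kN) fS (subnSK lt_kN) => IHk.
have -> : qpoch_fin p p N * (1 - p ^+ k.+1 * p ^+ (N - k)) =
  qpoch_fin p p N * (1 - p ^+ (N - k)) +
  p ^+ (N - k) * (qpoch_fin p p N * (1 - p ^+ k.+1)) by ring.
by rewrite -{1}IHk1 -IHk; ring.
Qed.

(** The q-binomial theorem, made homogeneous by u: with u = p^n it yields a two-sided product
    without negative powers of q. *)
Lemma gbin_prod N (u z : fps int) :
  \prod_(j < N) (u + z * p ^+ j) =
  \sum_(k < N.+1) p ^+ 'C(k, 2) * gbin N k * z ^+ k * u ^+ (N - k).
Proof.
elim: N => [|N IHN].
  by rewrite big_ord0 big_ord1 !mulr1.
rewrite big_ord_recr IHN /= mulrDr [RHS]big_ord_recl /=.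
have -> : \sum_(i < N.+1) p ^+ 'C(bump 0 i, 2) *
    (gbin N i.+1 + p ^+ (N - i) * gbin N i) * z ^+ bump 0 i *
    u ^+ (N.+1 - bump 0 i) =
  \sum_(i < N.+1) p ^+ 'C(i.+1, 2) * gbin N i.+1 * z ^+ i.+1 * u ^+ (N - i) +
  (\sum_(i < N.+1) p ^+ 'C(i, 2) * gbin N i * z ^+ i * u ^+ (N - i)) *
  (z * p ^+ N).
  rewrite mulr_suml -big_split; apply: eq_bigr => i _ /=.
  have le_iN : (i <= N)%N by rewrite -ltnS.
  rewrite /bump /= add1n subSS.
  have -> : p ^+ N = p ^+ i * p ^+ (N - i) by rewrite -exprD subnKC.
  by rewrite binS bin1 exprD !exprS; ring.
rewrite addrA; congr (_ + _).
rewrite mulr_suml big_ord_recl [in RHS]big_ord_recr /= (@gbin_small N N.+1) //.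
rewrite mulr0 !mul0r addr0 gbin0 !subn0 !mulr1 !mul1r -exprSr.
congr (_ + _); apply: eq_bigr => i _; rewrite /bump /= add1n.
have -> : u ^+ (N - i) = u ^+ (N - i.+1) * u by rewrite -exprSr subnSK.
by rewrite mulrA.
Qed.

End Gauss.

Definition tri (n : int) : int := ((n * (n - 1)) %/ 2)%Z.

Lemma tri2 n : 2 * tri n = n * (n - 1).
Proof.
have [k nk] : exists k, n * (n - 1) = 2 * k; last by rewrite /tri nk mulKz.
have [j [->|->]] : exists j, n = 2 * j \/ n = 2 * j + 1.
- by exists (n %/ 2)%Z; lia.
- by exists (j * (2 * j - 1)); ring.
- by exists (j * (2 * j + 1)); ring.
Qed.

Definition thexp (a m : nat) (n : int) : int := m%:Z * tri n + a%:Z * n.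

Lemma thexp_lb a m n : (0 < m)%N -> (a <= m)%N ->
  0 <= thexp a m n /\ `|n|%N%:Z <= thexp a m n + 1.
Proof.
move=> m0 le_am; rewrite /thexp; have := tri2 n; move: (tri n) => t t2.
case: (lerP 0 n) => n0.
  have t0 : 0 <= t /\ n - 1 <= t by split; nia.
  have : t <= m%:Z * t by nia.
  have : 0 <= a%:Z * n by nia.
  by lia.
(* For negative n the exponent is m (t + n) + (m - a) (- n), where t + n = n (n + 1) / 2. *)
have t0 : 0 <= t + n /\ - n - 1 <= t + n by split; nia.
have : t + n <= m%:Z * (t + n) by nia.
have : 0 <= (m%:Z - a%:Z) * - n by nia.
by lia.
Qed.

Lemma coercive_thexp a m : (0 < m)%N -> (a <= m)%N -> coercive (thexp a m).
Proof.
move=> m0 le_am; split=> [n|N]; first by case: (thexp_lb n m0 le_am).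
exists [seq k%:Z - N.+1%:Z | k <- iota 0 (2 * N).+3] => n le_nN.
have [_ lb] := thexp_lb (n : int) m0 le_am.
apply/mapP; exists (absz (n + N.+1%:Z)); rewrite ?mem_iota; lia.
Qed.

(** In Ramanujan's notation, f(-s q^a, -s q^(m-a)). The sign s is the one in the product of
    [jacobi_triple]: s = 1 gives factors 1 - q^j and alternating terms, s = -1 gives factors 1 + q^j
    and positive terms. *)
Definition th (s : int) (a m : nat) : fps int :=
  lsum (thexp a m) (fun n => (- s) ^+ `|n|%N).

Lemma coef0Xn m : (0 < m)%N -> ('q ^+ m) 0%N = 0 :> int.
Proof. by move=> m0; rewrite fps_coefXn eq_sym -leqn0 leqNgt m0. Qed.

Section Limit.
Variables (s : int) (a b : nat).
Hypotheses (s1 : s * s = 1) (ab0 : (0 < a + b)%N).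
Let m := (a + b)%N.
Let p := 'q ^+ m.
Let c : fps int := (- s)%:~R.

Let c1 : c * c = 1.
Proof. by rewrite /c -intrM mulrNN s1. Qed.

Let p0 : p 0%N = 0. Proof. exact: coef0Xn. Qed.

Let binE n : ('C(n, 2))%:Z = tri n%:Z.
Proof.
have := tri2 n%:Z; have: (2 * 'C(n, 2) = n * n.-1)%N.
  rewrite bin2 mul2n; have := odd_double_half (n * n.-1); rewrite oddM.
  by case: n => //= n; rewrite andNb.
by case: n => [|n] /=; lia.
Qed.

(** This is [gbin_prod] for 2n factors with u = p^n and z = - s q^a: after powers of q are taken
    out, the n factors of higher index give the first product and the n others the second. Both
    sides are first multiplied by these powers, since q is not invertible. *)
Lemma finite_triple n :
  \prod_(j < n) (1 - s%:~R * 'q ^+ a * p ^+ j) *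
  \prod_(j < n) (1 - s%:~R * 'q ^+ b * p ^+ j) =
  \sum_(k < (n + n).+1) gbin p (n + n) k *
    (((- s) ^+ absz (k%:Z - n%:Z))%:~R * 'q ^+ absz (thexp a m (k%:Z - n%:Z))).
Proof.
have e2 : p ^+ 'C(n, 2) * p ^+ (n * n) * (c * 'q ^+ a) ^+ n =
    c ^+ n * 'q ^+ (m * ('C(n, 2) + n * n) + a * n).
  by rewrite exprMn -!exprM -exprD [_ * (c ^+ n * _)]mulrCA -exprD mulnDr.
have cn f g : c ^+ n * f = c ^+ n * g -> f = g.
  move=> fg; have : c ^+ n * c ^+ n * f = c ^+ n * c ^+ n * g.
    by rewrite -!mulrA fg.
  by rewrite -exprMn c1 expr1n !mul1r.
apply: (@fpsXn_lreg _ (m * ('C(n, 2) + n * n) + a * n)); apply: cn.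
rewrite !mulrA -e2.
have := gbin_prod p (n + n) (p ^+ n) (c * 'q ^+ a).
rewrite big_split_ord /= => gE.
have qab : 'q ^+ a * 'q ^+ b = p by rewrite -exprD.
have upper : \prod_(j < n) (p ^+ n + c * 'q ^+ a * p ^+ (n + j)) =
    p ^+ (n * n) * \prod_(j < n) (1 - s%:~R * 'q ^+ a * p ^+ j).
  have -> : p ^+ (n * n) = \prod_(j < n) p ^+ n.
    by rewrite prodr_const card_ord exprM.
  rewrite -big_split; apply: eq_bigr => j _ /=.
  by rewrite exprD /c mulrNz; ring.
have lower : \prod_(j < n) (p ^+ n + c * 'q ^+ a * p ^+ j) =
    p ^+ 'C(n, 2) * (c * 'q ^+ a) ^+ n *
    \prod_(j < n) (1 - s%:~R * 'q ^+ b * p ^+ j).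
  have -> : p ^+ 'C(n, 2) = \prod_(j < n) p ^+ (n - j.+1).
    rewrite -(big_mkord xpredT (fun j => p ^+ (n - j.+1))) prodrXr.
    by congr (_ ^+ _); rewrite -bin2_sum big_nat_rev; apply: eq_big_nat => j; lia.
  have -> : (c * 'q ^+ a) ^+ n = \prod_(j < n) (c * 'q ^+ a).
    by rewrite prodr_const card_ord.
  (* In reverse order, p^n = p^(n-j-1) q^a q^b p^j, so that c q^a p^(n-j-1) can be taken out; c is
     its own inverse. *)
  rewrite -!big_split [LHS](reindex_inj rev_ord_inj); apply: eq_bigr => j _ /=.
  have -> : p ^+ n = p ^+ (n - j.+1) * ('q ^+ a * 'q ^+ b) * p ^+ j.
    rewrite qab -exprSr -exprD; congr (_ ^+ _); have := ltn_ord j; lia.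
  have -> : s%:~R = - c by rewrite /c mulrNz opprK.
  transitivity (p ^+ (n - j.+1) * (c * 'q ^+ a) +
      (c * c) * p ^+ (n - j.+1) * ('q ^+ a * 'q ^+ b) * p ^+ j); last by ring.
  by rewrite c1; ring.
transitivity (\prod_(j < n) (p ^+ n + c * 'q ^+ a * p ^+ j) *
    \prod_(j < n) (p ^+ n + c * 'q ^+ a * p ^+ (n + j))).
  by rewrite upper lower; ring.
rewrite gE mulr_sumr; apply: eq_bigr => k _.
have le_k : (k <= n + n)%N by rewrite -ltnS.
have -> : (c * 'q ^+ a) ^+ k = c ^+ k * 'q ^+ (a * k) by rewrite exprMn exprM.
have [E0 _] := thexp_lb (k%:Z - n%:Z) ab0 (leq_addr b a).
have cE : c ^+ k = c ^+ n * ((- s) ^+ absz (k%:Z - n%:Z))%:~R.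
  rewrite rmorphXn /= -/c; have cc d : c ^+ d * c ^+ d = 1.
    by rewrite -exprMn c1 expr1n.
  have [le_kn|lt_nk] := leqP k n.
    have -> : absz (k%:Z - n%:Z) = (n - k)%N by lia.
    have -> : c ^+ n = c ^+ k * c ^+ (n - k) by rewrite -exprD subnKC.
    by rewrite -mulrA cc mulr1.
  have -> : absz (k%:Z - n%:Z) = (k - n)%N by lia.
  by rewrite -exprD subnKC // ltnW.
have key : ('C(k, 2))%:Z + n%:Z * (n%:Z + n%:Z - k%:Z) =
    ('C(n, 2))%:Z + n%:Z * n%:Z + tri (k%:Z - n%:Z).
  rewrite !binE; have := tri2 k; have := tri2 n; have := tri2 (k%:Z - n%:Z).
  lia.
have qE : p ^+ 'C(k, 2) * 'q ^+ (a * k) * (p ^+ n) ^+ (n + n - k) =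
    'q ^+ (m * ('C(n, 2) + n * n) + a * n) *
    'q ^+ absz (thexp a m (k%:Z - n%:Z)).
  rewrite -!exprM -!exprD; congr (_ ^+ _).
  have dE : (n + n - k)%N%:Z = n%:Z + n%:Z - k%:Z by lia.
  move: E0 key; rewrite /thexp -dE; move: (n + n - k)%N (tri _) => d t.
  move=> E0 /(congr1 ( *%R m%:Z)) key.
  have key2 := congr1 (fun x : int => a%:Z * x) (subrK n%:Z k%:Z).
  by apply/eqP; rewrite -eqz_nat !PoszD !PoszM !PoszD !PoszM gez0_abs //; lia.
transitivity (c ^+ n * (((- s) ^+ absz (k%:Z - n%:Z))%:~R * gbin p (n + n) k) *
  ('q ^+ (m * ('C(n, 2) + n * n) + a * n) *
   'q ^+ absz (thexp a m (k%:Z - n%:Z)))); first by rewrite -qE cE; ring.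
by rewrite e2; ring.
Qed.

Let E := qpoch p p.

Let E_unit : E \is a GRing.unit.
Proof. by rewrite fps_unitE qpoch_coef0 ?unitr1. Qed.

(** In [gbin_fact] the indices k, n - k and n all exceed N, so modulo q^(N+1) each finite product
    may be replaced with E, and one factor E is then cancelled. *)
Lemma gbin_limit N n k : (N < k)%N -> (N + k < n)%N ->
  fps_eqmod N (E * gbin p n k) 1.
Proof.
move=> lt_Nk lt_n; have le_kn : (k <= n)%N by lia.
have modE j : (N < j)%N -> fps_eqmod N E (qpoch_fin p p j) by apply: qpoch_eqmod.
have EE : fps_eqmod N (gbin p n k * (E * E)) E.
  move=> i le_iN; rewrite (modE n _ i) -?(gbin_fact p le_kn) //; last by lia.
  have kmod : fps_eqmod N (E * E) (qpoch_fin p p k * qpoch_fin p p (n - k)).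
    by apply: fps_eqmodM; apply: modE; lia.
  by apply: (fps_eqmodM _ kmod).
move=> i le_iN; have := @fps_eqmodM _ N _ _ E^-1 E^-1 EE (fun _ _ => erefl) i le_iN.
by rewrite divrr // -mulrA mulrK // mulrC.
Qed.

Lemma jacobi_triple :
  th s a m = qpoch (s%:~R * 'q ^+ a) p * qpoch (s%:~R * 'q ^+ b) p * E.
Proof.
(* By [thexp_lb] a term of degree at most N has |k - n| <= N + 1. With this n, both k and 2n - k
   then exceed N, as [gbin_limit] requires. *)
apply: fpsP => N; pose n := (N + N).+2.
have modN z : fps_eqmod N (qpoch z p) (qpoch_fin z p n).
  by apply: qpoch_eqmod => //; lia.
transitivity ((\sum_(k < (n + n).+1) gbin p (n + n) k * (((- s) ^+
   absz (k%:Z - n%:Z))%:~R * 'q ^+ absz (thexp a m (k%:Z - n%:Z))) * E) N);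
  last first.
  rewrite -mulr_suml -finite_triple; apply: fps_eqmodM (leqnn N) => //.
  by move=> i le_i; apply/esym/(fps_eqmodM _ _ le_i).
pose S := [seq k%:Z - n%:Z | k <- iota 0 (n + n).+1].
have S_uniq : uniq S.
  by rewrite map_inj_uniq ?iota_uniq // => x y; lia.
have le_am : (a <= m)%N by apply: leq_addr.
rewrite (lsumE _ S_uniq) => [|j ejN]; last first.
  have [_] := thexp_lb j ab0 le_am; rewrite -/m ejN => lb.
  by apply/mapP; exists (absz (j + n%:Z)); rewrite ?mem_iota /n in lb *; lia.
rewrite big_map -[iota _ _]/(index_iota 0 (n + n).+1) big_mkord.
rewrite fps_coef_sum big_mkcond; apply: eq_bigr => k _.
have [e0 lb] := thexp_lb (k%:Z - n%:Z) ab0 le_am; rewrite -/m in e0 lb *.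
set x := gbin _ _ _; set y := _%:~R; set j := absz (thexp _ _ _).
have -> : x * (y * 'q ^+ j) * E = y * ('q ^+ j * (E * x)) by ring.
rewrite /y fps_coef_intl fps_coefXnM intz.
case: ltnP => [ltNj|le_jN]; first by rewrite ifF ?mulr0 //; apply/eqP; lia.
rewrite /x (gbin_limit (N := N)) ?leq_subr ?fps_coef1 //; [|lia|lia].
case: eqP => [ejN|nejN]; first by rewrite (_ : N - j = 0)%N ?mulr1 //; lia.
by rewrite (_ : (N - j == 0)%N = false) ?mulr0 //; lia.
Qed.

End Limit.

End JacobiTripleProduct.

(** * Products and dissections of theta series *)

Section ThetaIdentities.

Lemma sqr1_int (s : int) : s * s = 1 -> s = 1 \/ s = - 1.
Proof. by move=> s1; nia. Qed.

Lemma sgnzD (s : int) (n k : int) : s * s = 1 ->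
  (- s) ^+ absz (n + k) = (- s) ^+ absz n * (- s) ^+ absz k.
Proof.
move=> /sqr1_int[]->; last by rewrite opprK !expr1n.
rewrite -exprD -signr_odd -[RHS]signr_odd; congr (_ ^+ _); lia.
Qed.

Lemma sgnz_even (s : int) (n : int) : s * s = 1 -> (- s) ^+ absz (2 * n) = 1.
Proof. by move=> s1; rewrite abszM exprM expr2 mulrNN s1 expr1n. Qed.

Lemma sgnzN1 (n : int) : (- (-1 : int)) ^+ absz n = 1.
Proof. by rewrite opprK expr1n. Qed.

Lemma th_refl s a m : s * s = 1 -> (0 < m)%N -> (a <= m)%N ->
  th s (m - a) m = th s a m.
Proof.
move=> s1 m0 le_am; have := @jacobi_triple s a (m - a) s1.
have := @jacobi_triple s (m - a) a s1; rewrite subnK // subnKC //.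
by move=> -> // -> //; rewrite [X in X * _]mulrC.
Qed.

(** Even and odd n are separated. On each class (-s)^n is constant, hence the positive series on the
    right. *)
Lemma th_split s a m : s * s = 1 -> (0 < m)%N -> (2 * a <= m)%N ->
  th s a m = th (-1) (m + 2 * a) (4 * m) -
    s%:~R * ('q ^+ a * th (-1) (3 * m + 2 * a) (4 * m)).
Proof.
move=> s1 m0 le_am; have e'p : coercive (thexp (3 * m + 2 * a) (4 * m)).
  by apply: coercive_thexp; lia.
rewrite -mulNr -intrN -(lsumX _ _ _ e'p).
have thp : coercive (thexp a m) by apply: coercive_thexp; lia.
rewrite /th (@lsum_cover 2 _ int (fun r n => 2 * n + r%:Z) _ _ _ _ thp).
- rewrite big_ord_recl big_ord1 /=; congr (_ + _); apply: lsum_ext => n /=.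
  + have -> : thexp a m (2 * n + 0) = m%:Z * (4 * tri n + n) + a%:Z * (2 * n).
      by rewrite /thexp addr0; congr (_ * _ + _); have := tri2 (2 * n); have := tri2 n; lia.
    by rewrite /thexp; lia.
  + by rewrite addr0 sgnz_even ?sgnzN1.
  + have -> : thexp a m (2 * n + 1) =
        m%:Z * (4 * tri n + 3 * n) + a%:Z * (2 * n + 1).
      by rewrite /thexp; congr (_ * _ + _); have := tri2 (2 * n + 1); have := tri2 n; lia.
    by rewrite /thexp; lia.
  + by rewrite sgnzD // sgnz_even ?sgnzN1 // mul1r mulr1.
- move=> r r' n n' e; have lt := ltn_ord r; have lt' := ltn_ord r'.
  by split; [apply/val_inj => /=|]; lia.
- move=> n; have [e|e] : n = 2 * (n %/ 2)%Z \/ n = 2 * (n %/ 2)%Z + 1 by lia.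
    by exists ord0, (n %/ 2)%Z; rewrite /= addr0 -e.
  by exists ord_max, (n %/ 2)%Z; rewrite /= -e.
Qed.

(** A case of Schröter's formula. Pairs (i, j) are separated by the parity of i + j, and the form
    i^2 + j^2 becomes 2 u^2 + 2 v^2 up to linear terms in the coordinates of either coset. *)
Lemma th_mul s s' a b m : s * s = 1 -> s' * s' = 1 ->
  (0 < m)%N -> (a <= b)%N -> (a + b <= m)%N ->
  th s a m * th s' b m =
  th (- (s * s')) (a + b) (2 * m) * th (- (s * s')) (m + a - b) (2 * m) -
  s%:~R * ('q ^+ a * (th (- (s * s')) (m + a + b) (2 * m) *
                      th (- (s * s')) (b - a) (2 * m))).
Proof.
move=> s1 s'1 m0 le_ab le_abm; rewrite /th.
have coe k l : (k <= 2 * m)%N -> (l <= 2 * m)%N ->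
    coercive (fun x : int * int => thexp k (2 * m) x.1 + thexp l (2 * m) x.2).
  by move=> lek lel; apply: coercive_pair; apply: coercive_thexp; lia.
rewrite !lsumM; try by apply: coercive_thexp; lia.
rewrite -mulNr -intrN -lsumX; last by apply: coe; lia.
pose h (r : 'I_2) (x : int * int) : int * int :=
  if r == ord0 then (x.1 + x.2, x.1 - x.2) else (x.1 - x.2 + 1, x.1 + x.2).
rewrite (@lsum_cover 2 _ _ h).
- have T0 (u v : int) : tri (u + v) + tri (u - v) = 2 * tri u + 2 * tri v + v.
    have := tri2 (u + v); have := tri2 (u - v); have := tri2 u; have := tri2 v.
    lia.
  have T1 (u v : int) : tri (u - v + 1) + tri (u + v) = 2 * tri u + u + 2 * tri v.
    have := tri2 (u - v + 1); have := tri2 (u + v); have := tri2 u.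
    by have := tri2 v; lia.
  rewrite big_ord_recl big_ord1 /h /=; congr (_ + _); apply: lsum_ext => -[u v] /=.
  + have := congr1 ( *%R m%:Z) (T0 u v); rewrite /thexp.
    have -> : (m + a - b)%N%:Z = m%:Z + a%:Z - b%:Z by lia.
    lia.
  + by rewrite !sgnzD // abszN opprK -[s * s']mulrNN !exprMn mulrACA.
  + have E : m%:Z * tri (u - v + 1) + a%:Z * (u - v + 1) +
        (m%:Z * tri (u + v) + b%:Z * (u + v)) =
        a%:Z + ((2 * m)%N%:Z * tri u + (m + a + b)%N%:Z * u +
                ((2 * m)%N%:Z * tri v + (b - a)%N%:Z * v)).
      have := congr1 ( *%R m%:Z) (T1 u v).
      have -> : (b - a)%N%:Z = b%:Z - a%:Z by lia.
      lia.
    exact: E.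
  + rewrite !sgnzD // abszN opprK -[s * s']mulrNN !exprMn /= expr1.
    move: (_ ^+ _) (_ ^+ _) (_ ^+ _) (_ ^+ _) => x y z t; ring.
- move=> r r' [u v] [u' v']; rewrite /h -!val_eqE /=.
  have := ltn_ord r; have := ltn_ord r' => lt lt'.
  case: eqP => er; case: eqP => er' [e1 e2];
    by split; [apply/val_inj => /=|congr (_, _)]; lia.
- move=> [i j]; have [e|e] : i + j = 2 * ((i + j) %/ 2)%Z \/
      i + j = 2 * ((i + j) %/ 2)%Z + 1 by lia.
    by exists ord0, (((i + j) %/ 2)%Z, i - ((i + j) %/ 2)%Z); congr (_, _) => /=; lia.
  exists ord_max, (((i + j) %/ 2)%Z, j - ((i + j) %/ 2)%Z).
  by congr (_, _) => /=; lia.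
- by apply: coercive_pair; apply: coercive_thexp; lia.
Qed.

Lemma lsum_antisym (I : choiceType) (h : I -> I) (e c : I -> int) :
  involutive h -> (forall i, e (h i) = e i) -> (forall i, c (h i) = - c i) ->
  lsum e c = 0.
Proof.
move=> hK eh ch; have e2 : lsum e c = - lsum e c.
  rewrite {1}(@lsum_bij _ _ h e c e (fun i => -1 * c i)) ?mulN1r //; first last.
  - by move=> i; rewrite ch mulN1r.
  - by move=> i; exists (h i).
  - exact: inv_inj.
  apply: fpsP => N /=; rewrite -mulr_fsumr mulN1r //.
apply: fpsP => N; have /eqP := congr1 (fun f : fps int => f N) e2.
by rewrite fps_coefN fps_coef0 -addr_eq0 -mulr2n mulrn_eq0 => /eqP.
Qed.

(** The form i^2 + 2 j^2 is dissected by i - 2 j modulo 3: i = n + 2 t and j = t - n turn it into 3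
    n^2 + 6 t^2. The second class remains a raw sum, because its linear coefficient 2 m + 3 a may
    exceed the modulus 3 m; the two forms of the quintuple product identity below treat the two
    cases. *)
Lemma th_prod_split3 a m : (0 < m)%N -> (2 * a <= m)%N ->
  th (-1) a m * th 1 (m - 2 * a) (2 * m) =
  th 1 (2 * m) (6 * m) * th 1 (m + 3 * a) (3 * m) +
  lsum (fun x : int * int => thexp (2 * m) (6 * m) x.1 +
          (a%:Z + m%:Z * (3 * tri x.2 + 2 * x.2) + 3 * a%:Z * x.2))
       (fun x => (-1) ^+ absz x.1 * (-1) ^+ absz x.2).
Proof.
move=> m0 le_am; rewrite /th.
rewrite [LHS]lsumM; try by apply: coercive_thexp; lia.
pose h (r : 'I_3) (x : int * int) : int * int :=
  if r == ord0 then (x.2 + 2 * x.1, x.1 - x.2) else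
  if r == ord_max then (x.2 + 2 + 2 * x.1, x.1 - x.2) else
  (x.2 + 1 - 2 * x.1, - x.1 - x.2).
have aE : (m - 2 * a)%N%:Z = m%:Z - 2 * a%:Z by lia.
have T0 (t n : int) : m%:Z * tri (n + 2 * t) + 2 * m%:Z * tri (t - n) +
    m%:Z * (t - n) = m%:Z * (6 * tri t + 2 * t) + m%:Z * (3 * tri n + n).
  rewrite -!mulrDr -mulrA [2 * (_ * _)]mulrCA -!mulrDr; congr (_ * _).
  have := tri2 (n + 2 * t); have := tri2 (t - n); have := tri2 n.
  by have := tri2 t; lia.
have T1 (t n : int) : m%:Z * tri (n + 1 - 2 * t) + 2 * m%:Z * tri (- t - n) +
    m%:Z * (- t - n) = m%:Z * (6 * tri t + 2 * t) + m%:Z * (3 * tri n + 2 * n).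
  rewrite -!mulrDr -mulrA [2 * (_ * _)]mulrCA -!mulrDr; congr (_ * _).
  have := tri2 (n + 1 - 2 * t); have := tri2 (- t - n); have := tri2 n.
  by have := tri2 t; lia.
have T2 (t n : int) : m%:Z * tri (n + 2 + 2 * t) + 2 * m%:Z * tri (t - n) +
    m%:Z * (t - n) = m%:Z * (3 * (t * t) + 3 * t) + m%:Z * (3 * tri n + 3 * n + 1).
  rewrite -!mulrDr -mulrA [2 * (_ * _)]mulrCA -!mulrDr; congr (_ * _).
  have := tri2 (n + 2 + 2 * t); have := tri2 (t - n); have := tri2 n.
  lia.
have e2E (t n : int) : thexp a m (n + 2 + 2 * t) + thexp (m - 2 * a) (2 * m) (t - n) =
   m%:Z * (3 * (t * t) + 3 * t) + m%:Z * (3 * tri n + 3 * n + 1) +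
   a%:Z * (3 * n + 2).
  by rewrite -T2 /thexp aE; lia.
rewrite (@lsum_cover 3 _ _ h).
- rewrite !big_ord_recl big_ord0 addr0 /h /=.
  (* The antisymmetry [t -> -1-t] kills the third residue class. *)
  rewrite [X in _ + (_ + X)](@lsum_antisym _ (fun x : int * int => (-1 - x.1, x.2))).
  + rewrite addr0 lsumM; try by apply: coercive_thexp; lia.
    congr (_ + _); apply: lsum_ext => -[t n] /=.
    * have E : thexp a m (n + 2 * t) + thexp (m - 2 * a) (2 * m) (t - n) =
          thexp (2 * m) (6 * m) t + thexp (m + 3 * a) (3 * m) n.
        by rewrite /thexp aE; have := T0 t n; lia.
      exact: E.
    * by rewrite sgnzN1 mul1r sgnzD // abszN.
    * have E : thexp a m (n + 1 - 2 * t) + thexp (m - 2 * a) (2 * m) (- t - n) =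
          thexp (2 * m) (6 * m) t +
          (a%:Z + m%:Z * (3 * tri n + 2 * n) + 3 * a%:Z * n).
        by rewrite /thexp aE; have := T1 t n; lia.
      exact: E.
    * by rewrite sgnzN1 mul1r sgnzD // !abszN.
  + by move=> [t n] /=; congr (_, _); lia.
  + move=> [t n]; have E := e2E (-1 - t) n; have E' := e2E t n.
    rewrite /= [LHS]E [RHS]E'; lia.
  + move=> [t n] /=; rewrite !sgnzN1 !mul1r !sgnzD // !abszN.
    by rewrite expr1 !mulN1r mulNr.
- move=> r r' [t n] [t' n']; rewrite /h -!val_eqE /=.
  have := ltn_ord r; have := ltn_ord r' => lt lt' e.
  suff: [/\ nat_of_ord r = r', t = t' & n = n'].
    by case=> er -> ->; split=> //; apply/val_inj.
  move: e; case: eqP => er; case: eqP => er'; [| |case: eqP => er''|case: eqP => er''];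
    rewrite ?[if _ then _ else _]if_same; try case: eqP => er3; move=> [e1 e2]; split; lia.
- move=> [i j].
  have [n [e|[e|e]]] : exists n, i - 2 * j = 3 * n \/ i - 2 * j = 3 * n + 1 \/
      i - 2 * j = 3 * n + 2 by exists ((i - 2 * j) %/ 3)%Z; lia.
  + by exists ord0, (j + n, n); rewrite /h /=; congr (_, _); lia.
  + exists (lift ord0 ord0), (- j - n, n); rewrite /h -!val_eqE /=.
    by congr (_, _); lia.
  + by exists ord_max, (j + n, n); rewrite /h -!val_eqE /=; congr (_, _); lia.
- by apply: coercive_pair; apply: coercive_thexp; lia.
Qed.

Lemma quintuple_low a m : (0 < m)%N -> (3 * a <= m)%N ->
  th (-1) a m * th 1 (m - 2 * a) (2 * m) =
  th 1 (2 * m) (6 * m) *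
  (th 1 (m + 3 * a) (3 * m) + 'q ^+ a * th 1 (2 * m + 3 * a) (3 * m)).
Proof.
move=> m0 le_am; rewrite th_prod_split3 //; last lia.
rewrite mulrDr; congr (_ + _); rewrite mulrCA /th lsumM; try by apply: coercive_thexp; lia.
rewrite -[RHS]mul1r -[X in _ = X * _]/(1%:~R) -lsumX; last first.
  by apply: coercive_pair; apply: coercive_thexp; lia.
apply: lsum_ext => -[t n] /=; last by rewrite mul1r.
by rewrite /thexp; lia.
Qed.

(** Since 2 m + 3 a >= 3 m here, n is shifted by 1 in the second class; the shift changes the sign
    and the power of q in front. *)
Lemma quintuple_high a m : (0 < m)%N -> (2 * a <= m)%N -> (m <= 3 * a)%N ->
  th (-1) a m * th 1 (m - 2 * a) (2 * m) =
  th 1 (2 * m) (6 * m) *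
  (th 1 (m + 3 * a) (3 * m) - 'q ^+ (m - 2 * a) * th 1 (3 * a - m) (3 * m)).
Proof.
move=> m0 le_am le_ma; rewrite th_prod_split3 //.
rewrite mulrDr; congr (_ + _).
rewrite mulrN mulrCA /th lsumM; try by apply: coercive_thexp; lia.
rewrite -[RHS]mulN1r -[X in _ = X * _]/((-1)%:~R) -lsumX; last first.
  by apply: coercive_pair; apply: coercive_thexp; lia.
apply: (@lsum_bij _ _ (fun x : int * int => (x.1, x.2 - 1))).
- by move=> [t n] [t' n'] /= [-> e]; congr (_, _); lia.
- by move=> [t n]; exists (t, n + 1) => /=; congr (_, _); lia.
- move=> [t n] /=; have T : tri (n - 1) = tri n - n + 1.
    by have := tri2 (n - 1); have := tri2 n; lia.
  have E : thexp (2 * m) (6 * m) t + (a%:Z + m%:Z * (3 * tri (n - 1) +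
      2 * (n - 1)) + 3 * a%:Z * (n - 1)) = (m - 2 * a)%N%:Z +
      (thexp (2 * m) (6 * m) t + thexp (3 * a - m) (3 * m) n).
    rewrite T /thexp.
    have -> : (m - 2 * a)%N%:Z = m%:Z - 2 * a%:Z by lia.
    have -> : (3 * a - m)%N%:Z = 3 * a%:Z - m%:Z by lia.
    lia.
  exact: E.
- by move=> [t n] /=; rewrite sgnzD // abszN expr1; ring.
Qed.

(** The pentagonal number series of (q; q)_oo, cut by n modulo 5. The representatives e from -2 to 2
    keep the new coefficient 35 + 15 e between 0 and 75. *)
Lemma euler_split5 :
  th 1 1 3 = th 1 35 75 - 'q * th 1 50 75 - 'q ^+ 2 * th 1 20 75 +
    'q ^+ 7 * th 1 5 75 + 'q ^+ 5 * th 1 65 75.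
Proof.
pose d (r : 'I_5) : int := nth 0 [:: 0; 1; -1; -2; 2] r.
rewrite {1}/th (@lsum_cover 5 _ _ (fun r n => 5 * n + d r)).
- rewrite !big_ord_recl big_ord0 addr0 /d /= !addrA.
  have dE k a e (n : int) : k%:Z = thexp 1 3 e -> (a%:Z : int) = 35 + 15 * e ->
      thexp 1 3 (5 * n + e) = k%:Z + thexp a 75 n.
    rewrite /thexp => -> ->; have := tri2 (5 * n + e); have := tri2 e.
    by have := tri2 n; lia.
  have shift k c a e : (a <= 75)%N -> (forall n, thexp 1 3 (5 * n + e) = k%:Z + thexp a 75 n) ->
      (- 1) ^+ absz e = c ->
      lsum (thexp 1 3 \o (fun n => 5 * n + e))%FUN
        ((fun n => (- 1) ^+ absz n) \o (fun n => 5 * n + e))%FUN =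
      c%:~R * ('q ^+ k * th 1 a 75).
    move=> le_a ee ec; rewrite -lsumX; last exact: coercive_thexp.
    apply: lsum_ext => n /=; first exact: ee.
    rewrite sgnzD // ec mulrC; congr (_ * _).
    by rewrite abszM exprM.
  rewrite (shift 0%N 1 35%N) // => [|n]; last by apply: dE => //; lia.
  rewrite (shift 1%N (-1) 50%N) // => [|n]; last by apply: dE => //; lia.
  rewrite (shift 2%N (-1) 20%N) // => [|n]; last by apply: dE => //; lia.
  rewrite (shift 7%N 1 5%N) // => [|n]; last by apply: dE => //; lia.
  rewrite (shift 5%N 1 65%N) // => [|n]; last by apply: dE => //; lia.
  ring.
- move=> r r' n n' e.
  have rd (x : 'I_5) : d x = 0 \/ d x = 1 \/ d x = -1 \/ d x = -2 \/ d x = 2.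
    case: x => -[|[|[|[|[|x]]]]] //=; rewrite /d /=; tauto.
  have dd : d r = d r' by have := rd r; have := rd r'; lia.
  split; last by move: e; rewrite /= dd; lia.
  apply/val_inj; move: dd; rewrite /d; case: r {e} => -[|[|[|[|[|x]]]]] //= _;
    by case: r' => -[|[|[|[|[|x']]]]].
- move=> n; have := divz_eq n 5; have : 0 <= (n %% 5)%Z < 5 by lia.
  move: (n %/ 5)%Z (n %% 5)%Z => k r r5 ->.
  have [->|[->|[->|[->|->]]]] : r = 0 \/ r = 1 \/ r = 2 \/ r = 3 \/ r = 4 by lia.
  + by exists (@Ordinal 5 0 isT), k; rewrite /d /=; lia.
  + by exists (@Ordinal 5 1 isT), k; rewrite /d /=; lia.
  + by exists (@Ordinal 5 4 isT), k; rewrite /d /=; lia.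
  + by exists (@Ordinal 5 3 isT), (k + 1); rewrite /d /=; lia.
  + by exists (@Ordinal 5 2 isT), (k + 1); rewrite /d /=; lia.
- by apply: coercive_thexp.
Qed.

(* The form [x ^ 2 + y ^ 2] on the cosets of the index 5 sublattice of [Z ^ 2]
   generated by [(2, -1)] and [(1, 2)]. *)
Lemma th_norm5 :
  th (-1) 1 2 ^+ 2 = th (-1) 5 10 ^+ 2 + 4%:R * ('q * (th (-1) 1 10 * th (-1) 3 10)).
Proof.
have coe a b : (a <= 10)%N -> (b <= 10)%N ->
    coercive (fun x : int * int => thexp a 10 x.1 + thexp b 10 x.2).
  by move=> lea leb; apply: coercive_pair; apply: coercive_thexp.
pose h (r : 'I_5) (x : int * int) : int * int :=
  if val r == 0%N then (2 * x.1 + x.2, 2 * x.2 - x.1) else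
  if val r == 1%N then (x.2 - 2 * x.1, 2 * x.2 + x.1 - 1) else
  if val r == 2%N then (2 * x.1 - x.2, 1 - 2 * x.2 - x.1) else
  if val r == 3%N then (1 - 2 * x.2 - x.1, x.2 - 2 * x.1) else
  (2 * x.2 + x.1 - 1, 2 * x.1 - x.2).
rewrite !expr2 [th (-1) 1 10 * _]mulrC /th !lsumM; try by apply: coercive_thexp.
have sq (n : int) : thexp 1 2 n = n * n.
  by rewrite /thexp; have := tri2 n; lia.
have lin (a : nat) (n : int) : thexp a 10 n = 5 * (n * n) + (a%:Z - 5) * n.
  by rewrite /thexp; have := tri2 n; lia.
rewrite (@lsum_cover 5 _ _ h).
- rewrite !big_ord_recl big_ord0 addr0; congr (_ + _).
    apply: lsum_ext => -[m n]; rewrite /h /=; last by rewrite !sgnzN1.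
    by rewrite !sq !lin; lia.
  (* The quarter turns of Z^2 permute the four nontrivial cosets, so each of them contributes q
     P. *)
  set P := lsum (fun x => thexp 3 10 x.1 + _) _.
  have PE e c : (forall x : int * int, e x = 1%N%:Z + (thexp 3 10 x.1 + thexp 1 10 x.2)) ->
      (forall x, c x = 1) -> lsum e c = 'q * P.
    move=> ee cc; rewrite -['q * P]mul1r -[X in X * (_ * P)]/(1%:~R) -['q]expr1.
    rewrite -lsumX; last exact: coe.
    by apply: lsum_ext => x; rewrite ?ee // cc !sgnzN1 !mulr1.
  rewrite !PE; first ring.
  + by move=> [m n]; rewrite /h /= !sq !lin; lia.
  + by move=> [m n]; rewrite /h /= !sgnzN1.
  + by move=> [m n]; rewrite /h /= !sq !lin; lia.
  + by move=> [m n]; rewrite /h /= !sgnzN1.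
  + by move=> [m n]; rewrite /h /= !sq !lin; lia.
  + by move=> [m n]; rewrite /h /= !sgnzN1.
  + by move=> [m n]; rewrite /h /= !sq !lin; lia.
  + by move=> [m n]; rewrite /h /= !sgnzN1.
- move=> r r' [m n] [m' n']; rewrite /h.
  have [lt lt'] := (ltn_ord r, ltn_ord r').
  suff: forall a b : nat, (a < 5)%N -> (b < 5)%N ->
    h (inord a) (m, n) = h (inord b) (m', n') -> a = b /\ (m, n) = (m', n').
    move=> H e; have [] := H r r' lt lt'; first by rewrite !inord_val.
    by move=> er ->; split=> //; apply/val_inj.
  move=> a b lta ltb; rewrite /h /= !inordK //.
  move: a b lta ltb => [|[|[|[|[|a]]]]] [|[|[|[|[|b]]]]] //= _ _ [e1 e2];
    split; first [lia | congr (_, _); lia].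
- move=> [u v].
  pose k := ((2 * u - v) %/ 5)%Z; pose r := ((2 * u - v) %% 5)%Z.
  have e : 2 * u - v = 5 * k + r by rewrite /k /r; lia.
  have r5 : 0 <= r < 5 by rewrite /r; lia.
  have ex (a : nat) m n : (a < 5)%N -> h (inord a) (m, n) = (u, v) ->
    exists r j, h r j = (u, v) by exists (inord a), (m, n).
  have [er|[er|[er|[er|er]]]] : r = 0 \/ r = 1 \/ r = 2 \/ r = 3 \/ r = 4 by lia.
  + by apply: (ex 0%N k (u - 2 * k)) => //; rewrite /h /= !inordK //=;
      congr (_, _); lia.
  + by apply: (ex 1%N (- k) (u - 2 * k)) => //; rewrite /h /= !inordK //=;
      congr (_, _); lia.
  + by apply: (ex 3%N (1 + 2 * k - u) (- k)) => //; rewrite /h /= !inordK //=;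
      congr (_, _); lia.
  + by apply: (ex 4%N (u - 1 - 2 * k) (k + 1)) => //; rewrite /h /= !inordK //=;
      congr (_, _); lia.
  + by apply: (ex 2%N (k + 1) (2 * (k + 1) - u)) => //; rewrite /h /= !inordK //=;
      congr (_, _); lia.
- by apply: coercive_pair; apply: coercive_thexp.
Qed.

End ThetaIdentities.

(** * Products of infinite q-Pochhammer symbols *)

(* Keeps unification from computing with power series. *)
Opaque qpoch fps_mul fps_inv fps_one.

Section ProductCalculus.

(* [(a, m, c)] stands for the factor [(q^a; q^m)_oo ^ c]. *)
Definition pl (L : seq (nat * nat * int)) : fps int :=
  \prod_(x <- L) qpoch ('q ^+ x.1.1) ('q ^+ x.1.2) ^ x.2.

Definition pl_valid (M : nat) (L : seq (nat * nat * int)) :=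
  all (fun x => [&& 0 < x.1.1, x.1.1 <= x.1.2 & x.1.2 %| M]%N) L.

Definition pl_pos (L : seq (nat * nat * int)) := all (fun x => 0 < x.1.1)%N L.

(* The exponent of [1 - q^r] in [pl L]. *)
Definition pl_exp (L : seq (nat * nat * int)) (r : nat) : int :=
  foldr (fun x e => if (r == x.1.1 %[mod x.1.2])%N then x.2 + e else e) 0 L.

Lemma qpochXn_unit a m : (0 < a)%N -> qpoch ('q ^+ a) ('q ^+ m) \is a GRing.unit.
Proof. by move=> a0; rewrite fps_unitE qpoch_coef0 ?unitr1 // coef0Xn. Qed.

Lemma pl_unit L : pl_pos L -> pl L \is a GRing.unit.
Proof.
elim: L => [|x L IHL]; first by rewrite /pl big_nil unitr1.
rewrite /pl big_cons /= => /andP[x0 L_ok].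
by rewrite unitrM unitrXz ?IHL // qpochXn_unit.
Qed.

Lemma pl_nil : pl [::] = 1. Proof. exact: big_nil. Qed.

Lemma pl_cons a m c L :
  pl ((a, m, c) :: L) = qpoch ('q ^+ a) ('q ^+ m) ^ c * pl L.
Proof. exact: big_cons. Qed.

Lemma pl_cons1 a m L : pl ((a, m, 1) :: L) = qpoch ('q ^+ a) ('q ^+ m) * pl L.
Proof. exact: pl_cons. Qed.

Lemma pl_consN1 a m L :
  pl ((a, m, -1) :: L) = (qpoch ('q ^+ a) ('q ^+ m))^-1 * pl L.
Proof. exact: pl_cons. Qed.

Lemma plM L L' : pl L * pl L' = pl (L ++ L').
Proof. by rewrite /pl big_cat. Qed.

Lemma plV L : pl_pos L -> (pl L)^-1 = pl [seq (x.1, - x.2) | x <- L].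
Proof.
elim: L => [|x L IHL] /=; first by rewrite /pl !big_nil invr1.
move=> /andP[x0 L_ok]; rewrite /pl !big_cons.
rewrite invrM ?unitrXz ?qpochXn_unit ?(pl_unit L_ok) // mulrC -/(pl L) IHL //=.
by rewrite invr_expz.
Qed.

Lemma plXn L n : pl L ^+ n = pl [seq (x.1, x.2 * n%:Z) | x <- L].
Proof.
rewrite /pl big_map -prodrXl; apply: eq_bigr => x _ /=.
by rewrite exprnP exprz_exp.
Qed.

(** The residue 0 is represented by M, hence [r.+1]: the product (q^0; q^M)_oo would vanish. *)
Lemma qpochXn_expand a m M : (0 < a)%N -> (a <= m)%N -> (0 < M)%N -> (m %| M)%N ->
  qpoch ('q ^+ a) ('q ^+ m) =
  \prod_(r < M | (r.+1 == a %[mod m])%N) qpoch ('q ^+ r.+1) ('q ^+ M).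
Proof.
move=> a0 le_am M0 /dvdnP[k Mk]; have m0 : (0 < m)%N by apply: leq_trans le_am.
have k0 : (0 < k)%N by move: M0; rewrite Mk muln_gt0 => /andP[].
rewrite (qpochM _ (coef0Xn m0) k0) -exprM mulnC -Mk.
case: k k0 Mk => // k _ Mk.
have lt_h (i : 'I_k.+1) : ((i * m + a).-1 < M)%N by have := ltn_ord i; nia.
rewrite [RHS](reindex_onto (fun i => Ordinal (lt_h i))
   (fun r : 'I_M => inord (r %/ m) : 'I_k.+1 )) /=; last first.
  move=> r /eqP; rewrite {1}(divn_eq r m) -addnS modnMDl => ra.
  have ltr : (r %% m < m)%N by rewrite ltn_mod.
  have era : a = (r %% m).+1.
    move: ra ltr; rewrite leq_eqVlt => ra /predU1P[e|lt].
      move: ra; rewrite e modnn => /esym/eqP/(dvdn_leq a0) le_ma.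
      by apply/eqP; rewrite eqn_leq le_am.
    move: ra; rewrite (modn_small lt); move: le_am; rewrite leq_eqVlt.
    by case/predU1P=> [->|lt_am]; [rewrite modnn | rewrite (modn_small lt_am) => <-].
  apply/val_inj; rewrite /= inordK; last first.
    by rewrite -[k.+1]/(k.+1) ltn_divLR // -Mk.
  by rewrite era addnS /= -divn_eq.
have iE (i : 'I_k.+1) : (i * m + a).-1.+1 = (i * m + a)%N.
  by rewrite prednK // addn_gt0 a0 orbT.
apply: eq_big => [i|i _].
  rewrite iE modnMDl eqxx /=; apply/esym/eqP/val_inj; rewrite /= inordK.
    have -> : (i * m + a).-1 = (i * m + a.-1)%N by rewrite -{1}(prednK a0) addnS.
    by rewrite divnMDl // divn_small ?addn0 // prednK.
  rewrite ltn_divLR //; have := ltn_ord i; nia.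
by rewrite iE -exprM -exprD addnC mulnC.
Qed.

Lemma prodr_exprz (I : finType) (P : pred I) (F : I -> fps int) (c : int) :
  (forall i, F i \is a GRing.unit) ->
  (\prod_(i | P i) F i) ^ c = \prod_(i | P i) F i ^ c.
Proof.
move=> Fu; suff [_ ->//] : (\prod_(i | P i) F i \is a GRing.unit) /\
  (\prod_(i | P i) F i) ^ c = \prod_(i | P i) F i ^ c.
apply: (big_rec2 (fun x y => x \is a GRing.unit /\ x ^ c = y)) => [|i x y _ [xu <-]].
  by rewrite unitr1 exp1rz.
by rewrite unitrM Fu xu exprMz_comm //; apply: mulrC.
Qed.

Lemma pl_expand M L : (0 < M)%N -> pl_valid M L ->
  pl L = \prod_(r < M) qpoch ('q ^+ r.+1) ('q ^+ M) ^ pl_exp L r.+1.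
Proof.
move=> M0; elim: L => [|[[a m] c] L IHL] /=.
  by rewrite /pl big_nil big1.
move=> /andP[/and3P[a0 le_am mM] L_ok].
rewrite /pl big_cons -/(pl L) IHL // (qpochXn_expand a0 le_am M0 mM).
rewrite prodr_exprz /=; last by move=> r; apply: qpochXn_unit.
rewrite big_mkcond -big_split; apply: eq_bigr => r _ /=.
case: ifP => _; last by rewrite mul1r.
by rewrite exprzDr // qpochXn_unit.
Qed.

Definition pl_check M L L' := [&& (0 < M)%N, pl_valid M L, pl_valid M L' &
  all (fun r => pl_exp L r.+1 == pl_exp L' r.+1) (iota 0 M)].

Lemma pl_eq M L L' : pl_check M L L' -> pl L = pl L'.
Proof.
case/and4P=> M0 L_ok L'_ok /allP e; rewrite !(pl_expand M0) //.
by apply: eq_bigr => r _; rewrite (eqP (e r _)) // mem_iota ltn_ord.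
Qed.

(** Factors 1 + q^j are expressed by factors 1 - q^j, so that lists need no signs. *)
Lemma qpochN a m : (0 < a)%N -> (0 < m)%N ->
  qpoch (- 'q ^+ a) ('q ^+ m) = pl [:: ((2 * a)%N, (2 * m)%N, 1); (a, m, -1)].
Proof.
move=> a0 m0; rewrite pl_cons1 pl_consN1 pl_nil.
have := qpochXn_unit m a0; have := qpoch_sqr ('q ^+ a) (coef0Xn m0).
rewrite -!exprM [(a * 2)%N]mulnC [(m * 2)%N]mulnC.
move: (qpoch ('q ^+ a) ('q ^+ m)) (qpoch (- 'q ^+ a) ('q ^+ m)) (qpoch ('q ^+ (2 * a)) _).
move=> x y z <- xu; by rewrite mulr1 mulrAC mulrV // mul1r.
Qed.

Lemma qpochP a m : qpoch ('q ^+ a) ('q ^+ m) = pl [:: (a, m, 1)].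
Proof. by rewrite /pl big_seq1. Qed.

Lemma thP1 a m : (a <= m)%N -> (0 < m)%N ->
  th 1 a m = pl [:: (a, m, 1); ((m - a)%N, m, 1); (m, m, 1)].
Proof.
move=> le_am m0; have := @jacobi_triple 1 a (m - a) erefl.
rewrite subnKC // => -> //; rewrite !mul1r !qpochP !plM //.
Qed.

Lemma thPN a m : (0 < a)%N -> (a < m)%N ->
  th (-1) a m = pl [:: ((2 * a)%N, (2 * m)%N, 1); (a, m, -1);
    ((2 * (m - a))%N, (2 * m)%N, 1); ((m - a)%N, m, -1); (m, m, 1)].
Proof.
move=> a0 lt_am; have := @jacobi_triple (-1) a (m - a) erefl.
rewrite subnKC ?(ltnW lt_am) // => ->; last by apply: leq_trans lt_am.
have mNq k : (-1)%:~R * 'q ^+ k = - 'q ^+ k by rewrite mulrNz mulN1r.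
by rewrite !mNq !qpochN ?qpochP ?plM //; lia.
Qed.

(** For a = 0 the triple product contains 1 + q^0 = 2, which no list can express. *)
Lemma thP0 m : (0 < m)%N ->
  th (-1) 0 m = 2%:R * pl [:: ((2 * m)%N, (2 * m)%N, 2); (m, m, -1)].
Proof.
move=> m0; have := @jacobi_triple (-1) 0 m erefl m0.
have mNq k : (-1)%:~R * 'q ^+ k = - 'q ^+ k by rewrite mulrNz mulN1r.
rewrite add0n !mNq expr0 (qpoch_recl _ (coef0Xn m0)) opprK mulN1r => ->.
have -> : pl [:: ((2 * m)%N, (2 * m)%N, 2); (m, m, -1)] =
    qpoch ('q ^+ (2 * m)) ('q ^+ (2 * m)) ^+ 2 * (qpoch ('q ^+ m) ('q ^+ m))^-1.
  by rewrite pl_cons pl_consN1 pl_nil; congr (_ * _); apply: mulr1.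
have := qpochXn_unit m m0; have := qpoch_sqr ('q ^+ m) (coef0Xn m0).
rewrite -!exprM [(m * 2)%N]mulnC.
move: (qpoch ('q ^+ m) ('q ^+ m)) (qpoch (- 'q ^+ m) ('q ^+ m)) (qpoch ('q ^+ (2 * m)) _).
move=> x y z <- /divrr; move: x^-1 => w xw.
transitivity (2%:R * (y ^+ 2 * x * (x * w))); last by ring.
by rewrite xw mulr1; ring.
Qed.

Lemma RRP k : (0 < k)%N -> RR ('q ^+ k) =
  pl [:: (k, (5 * k)%N, 1); ((4 * k)%N, (5 * k)%N, 1);
         ((2 * k)%N, (5 * k)%N, -1); ((3 * k)%N, (5 * k)%N, -1)].
Proof.
move=> k0; rewrite /RR -!exprM ![(k * _)%N]mulnC !qpochP !plM.
by rewrite plV ?plM //= !muln_gt0 k0.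
Qed.

Lemma RRNP k : (0 < k)%N -> RR (- 'q ^+ k) =
  pl [:: ((2 * k)%N, (20 * k)%N, 1); (k, (10 * k)%N, -1); ((6 * k)%N, (10 * k)%N, 1);
         ((4 * k)%N, (10 * k)%N, 1); ((18 * k)%N, (20 * k)%N, 1); ((9 * k)%N, (10 * k)%N, -1);
         ((2 * k)%N, (10 * k)%N, -1); ((14 * k)%N, (20 * k)%N, -1); ((7 * k)%N, (10 * k)%N, 1);
         ((6 * k)%N, (20 * k)%N, -1); ((3 * k)%N, (10 * k)%N, 1); ((8 * k)%N, (10 * k)%N, -1)].
Proof.
move=> k0; have base : ((- 'q ^+ k) ^+ 5) 0%N = 0 :> int.
  by rewrite fps_coef0X fps_coefN coef0Xn // oppr0 expr0n.
(* The base (- q^k)^5 carries a sign; taking every second factor replaces it with its square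
   q^(10k). *)
have two a : qpoch ((- 'q ^+ k) ^+ a) ((- 'q ^+ k) ^+ 5) =
    qpoch ((- 'q ^+ k) ^+ a) ('q ^+ (10 * k)) *
    qpoch ((- 'q ^+ k) ^+ (a + 5)) ('q ^+ (10 * k)).
  have bb : ((- 'q ^+ k) ^+ 5) ^+ 2 = 'q ^+ (10 * k).
    by rewrite exprAC sqrrN -!exprM; congr (_ ^+ _); lia.
  rewrite (qpochM _ base (isT : (0 < 2)%N)) big_ord_recl big_ord1 bb.
  by rewrite expr0 mulr1 expr1 -exprD.
have oddE a : odd a -> (0 < a)%N -> qpoch ((- 'q ^+ k) ^+ a) ('q ^+ (10 * k)) =
    pl [:: ((2 * (a * k))%N, (2 * (10 * k))%N, 1); ((a * k)%N, (10 * k)%N, -1)].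
  move=> oa a0; rewrite exprNn -signr_odd oa mulN1r -exprM mulnC qpochN //; lia.
have evenE a : ~~ odd a -> qpoch ((- 'q ^+ k) ^+ a) ('q ^+ (10 * k)) =
    pl [:: ((a * k)%N, (10 * k)%N, 1)].
  by move=> oa; rewrite exprNn -signr_odd (negPf oa) mul1r -exprM mulnC qpochP.
rewrite /RR -[X in qpoch X _]expr1 !two (oddE 1%N) // (evenE (1 + 5)%N) //
  (evenE 4%N) // (oddE (4 + 5)%N) // (evenE 2%N) // (oddE (2 + 5)%N) //
  (oddE 3%N) // (evenE (3 + 5)%N) // !plM.
rewrite plV ?plM /=; first by rewrite !mul1n !mulnA.
by rewrite ?muln_gt0 k0.
Qed.

End ProductCalculus.

(** * Supports modulo 5 *)

Section Supports.
Implicit Types f g : fps int.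

Definition supp (S : seq nat) f := forall n, (n %% 5)%N \notin S -> f n = 0.

Definition in_q5 f := exists g, f = fps_dilate 4 g.

Lemma suppM5 S f g : supp S f -> in_q5 g -> supp S (f * g).
Proof.
move=> fS [h ->] n nS; rewrite fps_coefM big1 // => i _ /=.
case: ifP => [d5|]; last by rewrite mulr0.
rewrite fS ?mul0r //; apply: contra nS.
suff -> : (n %% 5 = i %% 5)%N by [].
by have := ltn_ord i; lia.
Qed.

Lemma suppD S f g : supp S f -> supp S g -> supp S (f + g).
Proof. by move=> fS gS n nS; rewrite fps_coefD fS ?gS. Qed.

Lemma suppN S f : supp S f -> supp S (- f).
Proof. by move=> fS n nS; rewrite fps_coefN fS ?oppr0. Qed.

Lemma suppB S f g : supp S f -> supp S g -> supp S (f - g).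
Proof. by move=> fS gS; apply/suppD/suppN. Qed.

Lemma supp_natl S k f : supp S f -> supp S (k%:R * f).
Proof. by move=> fS n nS; rewrite fps_coef_natl fS ?mulr0. Qed.

Lemma suppXn S S' k f : supp S f ->
  all (fun s => ((k + s) %% 5)%N \in S') S -> supp S' ('q ^+ k * f).
Proof.
move=> fS /allP SS n nS; rewrite fps_coefXnM; case: ltnP => // le_kn.
apply: fS; apply: contra nS => /SS.
by rewrite modnDmr subnKC.
Qed.

Lemma in_q5M f g : in_q5 f -> in_q5 g -> in_q5 (f * g).
Proof. by move=> [f' ->] [g' ->]; exists (f' * g'); rewrite rmorphM. Qed.

Lemma in_q5_exprz f c : f \is a GRing.unit -> in_q5 f -> in_q5 (f ^ c).
Proof.
move=> fu [g fg]; rewrite fg; have gu : g \is a GRing.unit.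
  by move: fu; rewrite fg !fps_unitE /= div0n.
exists (g ^ c); case: c => c; first by rewrite -!exprnP rmorphXn.
by rewrite !NegzE -!exprnN rmorphV ?unitrX // rmorphXn.
Qed.

Lemma fps_dilateXn k n : fps_dilate k ('q ^+ n) = 'q ^+ (k.+1 * n).
Proof. by rewrite (rmorphXn (fps_dilate k)) /= fps_dilateX exprM. Qed.

Lemma qpochXn_in_q5 a m : (0 < a)%N -> (0 < m)%N -> (5 %| a)%N -> (5 %| m)%N ->
  in_q5 (qpoch ('q ^+ a) ('q ^+ m)).
Proof.
move=> a0 m0 /dvdnP[b ab] /dvdnP[k mk]; exists (qpoch ('q ^+ b) ('q ^+ k)).
have k0 : (0 < k)%N by move: m0; rewrite mk muln_gt0 => /andP[].
rewrite qpoch_dilate; last exact: coef0Xn.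
by rewrite !fps_dilateXn ab mk ![(5 * _)%N]mulnC.
Qed.

Definition pl_check5 M L := [&& (0 < M)%N, (5 %| M)%N, pl_valid M L &
  all (fun r => (5 %| r.+1)%N || (pl_exp L r.+1 == 0)) (iota 0 M)].

Lemma pl_in_q5 M L : pl_check5 M L -> in_q5 (pl L).
Proof.
case/and4P=> M0 M5 L_ok /allP e5; rewrite (pl_expand M0 L_ok).
apply: big_ind => [|f g|r _]; first by exists 1; rewrite rmorph1.
  exact: in_q5M.
have r_in : (r : nat) \in iota 0 M by rewrite mem_iota ltn_ord.
have /orP[r5|/eqP->] := e5 _ r_in; last by exists 1; rewrite rmorph1.
by apply: in_q5_exprz; [apply: qpochXn_unit | apply: qpochXn_in_q5].
Qed.

Lemma thexp_mod5 a m (n : int) :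
  (thexp a m n = thexp a m (n %% 5)%Z %[mod 5])%Z.
Proof.
have := divz_eq n 5; move: (n %/ 5)%Z (n %% 5)%Z => k r ->.
have T : tri (k * 5 + r) = 5 * (5 * tri k + (2 + r) * k) + tri r.
  have := tri2 (k * 5 + r); have := tri2 k; have := tri2 r; lia.
have -> : thexp a m (k * 5 + r) =
    (m%:Z * (5 * tri k + (2 + r) * k) + a%:Z * k) * 5 + thexp a m r.
  by rewrite /thexp T; lia.
by rewrite modzMDl.
Qed.

Lemma th_supp S s a m :
  all (fun r : nat => absz (thexp a m r%:Z %% 5)%Z \in S) (iota 0 5) ->
  (0 < m)%N -> (a <= m)%N -> supp S (th s a m).
Proof.
move=> /allP S5 m0 le_am n nS.
have coe := coercive_thexp m0 le_am.
have [l [l_uniq lP]] := coercive_seq n coe.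
rewrite /th (lsumE _ l_uniq) => [|i ei]; last by apply: lP; rewrite ei.
rewrite big1 // => i /eqP ei; case/negP: nS.
have := S5 (absz (i %% 5)%Z) _.
have -> : (absz (i %% 5)%Z)%:Z = (i %% 5)%Z by lia.
rewrite -thexp_mod5 ei => H.
have -> : (n %% 5)%N = absz (n%:Z %% 5)%Z by lia.
by apply: H; rewrite mem_iota; lia.
Qed.

Lemma supp_quot (S : seq nat) t (L L' : seq (nat * nat * int)) M f :
  supp S t -> t = pl L' -> f = pl L -> pl_pos L' ->
  pl_check5 M (L ++ [seq (x.1, - x.2) | x <- L']) -> supp S f.
Proof.
move=> tS tE -> L'_pos Lok; have -> : pl L = t * pl (L ++ [seq (x.1, - x.2) | x <- L']).
  by rewrite tE -plM -plV // mulrCA divrr ?mulr1 // pl_unit.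
exact: suppM5 tS (pl_in_q5 Lok).
Qed.

End Supports.

(** * The substitutions q -> -q and q -> q^k in R and in theta series *)

Section Morphisms.
Implicit Types f g x : fps int.

Definition neg : fps int -> fps int := fps_scale (-1).
HB.instance Definition _ := GRing.RMorphism.on neg.

Lemma negX : neg 'q = - 'q.
Proof. by apply: fpsP => -[|[|n]] /=; rewrite ?mulr0 ?expr1 ?mulr1 ?oppr0. Qed.

Lemma neg_coef f n : neg f n = (-1) ^+ n * f n. Proof. by []. Qed.

Lemma RR_rmorph (phi : {rmorphism fps int -> fps int}) x :
  (forall a b : fps int, b 0%N = 0 -> phi (qpoch a b) = qpoch (phi a) (phi b)) ->
  x 0%N = 0 -> phi (RR x) = RR (phi x).
Proof.
move=> phi_q x0; rewrite /RR.
have x50 : (x ^+ 5) 0%N = 0 by rewrite fps_coef0X x0 expr0n.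
have u : qpoch (x ^+ 2) (x ^+ 5) * qpoch (x ^+ 3) (x ^+ 5) \is a GRing.unit.
  by rewrite fps_unitE fps_coef0M !qpoch_coef0 ?fps_coef0X ?x0 ?expr0n ?mulr1 ?unitr1.
rewrite (rmorphM phi) (rmorphV phi u) !(rmorphM phi) !(phi_q _ _ x50).
by rewrite !(rmorphXn phi).
Qed.

Lemma RR_neg x : x 0%N = 0 -> neg (RR x) = RR (neg x).
Proof. by move=> x0; apply: RR_rmorph => // a b _; apply: qpoch_scale. Qed.

Lemma RR_dilate k x : x 0%N = 0 -> fps_dilate k (RR x) = RR (fps_dilate k x).
Proof. by move=> x0; apply: RR_rmorph => // a b; apply: qpoch_dilate. Qed.

Lemma th_dilate k s a m : s * s = 1 -> (0 < m)%N -> (a <= m)%N ->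
  fps_dilate k (th s a m) = th s (k.+1 * a) (k.+1 * m).
Proof.
move=> s1 m0 le_am; have := @jacobi_triple s (k.+1 * a) (k.+1 * (m - a)) s1.
rewrite -mulnDr; have := @jacobi_triple s a (m - a) s1.
rewrite subnKC // => -> // -> //; last by rewrite muln_gt0.
rewrite !(rmorphM (fps_dilate k)) /= !qpoch_dilate; try exact: coef0Xn.
rewrite !(rmorphM (fps_dilate k)) !(rmorph_int (fps_dilate k)) /=.
by rewrite !fps_dilateXn.
Qed.

End Morphisms.

Opaque qpoch fps_mul fps_inv fps_one fps_add fps_opp fpsX RR th.

Lemma RRP1 : RR 'q = pl [:: (1%N, 5%N, 1); (4%N, 5%N, 1); (2%N, 5%N, -1); (3%N, 5%N, -1)].
Proof. exact: (@RRP 1). Qed.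

Lemma RRNP1 : RR (- 'q) = pl [:: (2%N, 20%N, 1); (1%N, 10%N, -1); (6%N, 10%N, 1);
  (4%N, 10%N, 1); (18%N, 20%N, 1); (9%N, 10%N, -1); (2%N, 10%N, -1);
  (14%N, 20%N, -1); (7%N, 10%N, 1); (6%N, 20%N, -1); (3%N, 10%N, 1); (8%N, 10%N, -1)].
Proof. exact: (@RRNP 1). Qed.

Ltac pl_norm :=
  rewrite ?RRP1 ?RRNP1 ?RRP ?RRNP ?thP1 ?thPN //;
  repeat first [rewrite !plXn | rewrite !plM | rewrite plV //].

(** M is a common multiple of the moduli that occur; [thPN] doubles the modulus of a series with s =
    -1. *)
Ltac pl_solve M := pl_norm; apply: (@pl_eq M); vm_compute; reflexivity.

Lemma th_mulP s a b m : s * s = 1 -> (0 < m)%N -> (a <= b)%N -> (a + b <= m)%N ->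
  th 1 a m * th s b m =
  th (- s) (a + b) (2 * m) * th (- s) (m + a - b) (2 * m) -
  'q ^+ a * (th (- s) (m + a + b) (2 * m) * th (- s) (b - a) (2 * m)).
Proof. by move=> s1 *; rewrite th_mul // !mul1r. Qed.

Lemma th_mulN s a b m : s * s = 1 -> (0 < m)%N -> (a <= b)%N -> (a + b <= m)%N ->
  th (-1) a m * th s b m =
  th s (a + b) (2 * m) * th s (m + a - b) (2 * m) +
  'q ^+ a * (th s (m + a + b) (2 * m) * th s (b - a) (2 * m)).
Proof. by move=> s1 *; rewrite th_mul // mulN1r opprK mulrNz mulNr opprK mul1r. Qed.

(** Reflecting m + a + b keeps all exponents of the expansion at most m, so that different
    expansions share the same few theta series and can be compared by [ring]. *)
Lemma th_mulP' s a b m : s * s = 1 -> (0 < m)%N -> (a <= b)%N -> (a + b <= m)%N ->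
  th 1 a m * th s b m =
  th (- s) (a + b) (2 * m) * th (- s) (m + a - b) (2 * m) -
  'q ^+ a * (th (- s) (m - (a + b)) (2 * m) * th (- s) (b - a) (2 * m)).
Proof.
move=> s1 m0 le_ab le_abm.
have -> : (m - (a + b))%N = (2 * m - (m + a + b))%N by lia.
rewrite (@th_refl (- s) (m + a + b) (2 * m)); [exact: th_mulP | |lia|lia].
by rewrite mulrNN.
Qed.

Lemma th_mulN' s a b m : s * s = 1 -> (0 < m)%N -> (a <= b)%N -> (a + b <= m)%N ->
  th (-1) a m * th s b m =
  th s (a + b) (2 * m) * th s (m + a - b) (2 * m) +
  'q ^+ a * (th s (m - (a + b)) (2 * m) * th s (b - a) (2 * m)).
Proof.
move=> s1 m0 le_ab le_abm.
have -> : (m - (a + b))%N = (2 * m - (m + a + b))%N by lia.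
by rewrite (@th_refl s (m + a + b) (2 * m)); [exact: th_mulN | |lia|lia].
Qed.

Lemma th_splitP a m : (0 < m)%N -> (2 * a <= m)%N ->
  th 1 a m = th (-1) (m + 2 * a) (4 * m) - 'q ^+ a * th (-1) (m - 2 * a) (4 * m).
Proof.
move=> m0 le_am; have -> : (m - 2 * a)%N = (4 * m - (3 * m + 2 * a))%N by lia.
rewrite (@th_refl (-1) (3 * m + 2 * a) (4 * m)); [|by []|lia|lia].
have := @th_split 1 a m erefl m0 le_am.
by rewrite [1%:~R * _]mul1r.
Qed.

Lemma th_splitN a m : (0 < m)%N -> (2 * a <= m)%N ->
  th (-1) a m = th (-1) (m + 2 * a) (4 * m) + 'q ^+ a * th (-1) (m - 2 * a) (4 * m).
Proof.
move=> m0 le_am; have -> : (m - 2 * a)%N = (4 * m - (3 * m + 2 * a))%N by lia.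
rewrite (@th_refl (-1) (3 * m + 2 * a) (4 * m)); [|by []|lia|lia].
have := @th_split (-1) a m erefl m0 le_am.
by rewrite mulrNz mulNr opprK [1%:~R * _]mul1r.
Qed.

(** * Parts (vi) to (xi) *)

Local Notation R := (RR 'q).
Local Notation Rt := (RR (- 'q)).
Local Notation R2 := (RR ('q ^+ 2)).
Local Notation R4 := (RR ('q ^+ 4)).

(* [th_fac], [th_even] and [th_odd] are even, so that [RR_decomp] splits [R] into
   its even and odd parts. *)
Definition th_even := th 1 4 20 * th 1 8 20.
Definition th_odd := th 1 14 20 * th 1 2 20.
Definition th_fac := R / (th 1 1 10 * th (-1) 3 10).

Lemma RR_decomp : R = th_fac * (th_even - 'q * th_odd).
Proof.
have <- : th 1 1 10 * th (-1) 3 10 = th_even - 'q * th_odd.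
  by rewrite -['q]expr1; apply: (@th_mulP (-1) 1 3 10).
by rewrite /th_fac; pl_solve 20%N.
Qed.

(** That the same [th_fac] serves for R(-q) is a product identity: R(q) / R(-q) is the quotient of
    the two theta products which [th_mulP] and [th_mulN] expand. *)
Lemma RRN_decomp : Rt = th_fac * (th_even + 'q * th_odd).
Proof.
have <- : th (-1) 1 10 * th 1 3 10 = th_even + 'q * th_odd.
  by rewrite -['q]expr1; apply: (@th_mulN 1 1 3 10).
by rewrite /th_fac; pl_solve 20%N.
Qed.

Lemma negD (f g : fps int) : neg (f + g) = neg f + neg g.
Proof. exact: (rmorphD neg). Qed.
Lemma negM (f g : fps int) : neg (f * g) = neg f * neg g.
Proof. exact: (rmorphM neg). Qed.
Lemma negXn (f : fps int) n : neg (f ^+ n) = neg f ^+ n.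
Proof. exact: (rmorphXn neg). Qed.

Definition is_even (f : fps int) := neg f = f.

Lemma is_evenM f g : is_even f -> is_even g -> is_even (f * g).
Proof. by rewrite /is_even (rmorphM neg) /= => -> ->. Qed.

Lemma is_evenN f : is_even f -> is_even (- f).
Proof. by rewrite /is_even (rmorphN neg) /= => ->. Qed.

Lemma is_evenXn f n : is_even f -> is_even (f ^+ n).
Proof. by rewrite /is_even (rmorphXn neg) /= => ->. Qed.

Lemma is_evenV f : f \is a GRing.unit -> is_even f -> is_even f^-1.
Proof. by rewrite /is_even => fu; rewrite (rmorphV neg fu) /= => ->. Qed.

Lemma neg_evenX k : ~~ odd k -> is_even ('q ^+ k).
Proof.
move=> k_even; rewrite /is_even (rmorphXn neg) /= negX.
by rewrite exprNn -signr_odd (negPf k_even) expr0 mul1r.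
Qed.

Lemma neg_RR : neg R = Rt.
Proof. by rewrite RR_neg ?negX. Qed.

Lemma neg_RRN : neg Rt = R.
Proof.
rewrite RR_neg; last by rewrite fps_coefN; apply: oppr0.
by rewrite (rmorphN neg) /= negX opprK.
Qed.

Lemma neg_RR_even k : ~~ odd k -> (0 < k)%N -> is_even (RR ('q ^+ k)).
Proof. by move=> k_even k0; rewrite /is_even RR_neg ?neg_evenX ?coef0Xn. Qed.

Lemma neg_RRN_even k : ~~ odd k -> (0 < k)%N -> is_even (RR (- 'q ^+ k)).
Proof.
move=> k_even k0; rewrite /is_even RR_neg; last by rewrite fps_coefN coef0Xn // oppr0.
by rewrite (rmorphN neg) /= neg_evenX.
Qed.

Lemma RRXn_unit k : (0 < k)%N -> RR ('q ^+ k) \is a GRing.unit.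
Proof. by move=> k0; rewrite RR_unit ?coef0Xn. Qed.

Lemma RRNXn_unit k : (0 < k)%N -> RR (- 'q ^+ k) \is a GRing.unit.
Proof. by move=> k0; rewrite RR_unit // fps_coefN coef0Xn ?oppr0. Qed.

(** Here l' will be the inverse of l. Since q -> -q exchanges r and r', it suffices that l and l'
    contain the same power n of them: the difference, twice the odd part, then factors. *)
Lemma odd_part n (r r' l l' k e e' : fps int) :
  neg r = r' -> neg r' = r -> l = r ^+ n * e -> l' = r' ^+ n * e' ->
  is_even e -> is_even k -> is_even e' ->
  l + k * l' - neg (l + k * l') = (r ^+ n - r' ^+ n) * (e - k * e').
Proof.
move=> nr nr' -> -> ev kv ev'; rewrite negD !negM !negXn nr nr'.
by rewrite (ev : neg e = e) (ev' : neg e' = e') (kv : neg k = k); ring.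
Qed.

(* [A2 / B2 = R4 / R2 ^+ 2] and [Y2 / X2 = R2 * R4 ^+ 2]. *)
Definition A2 := th (-1) 2 10 * th 1 4 10.
Definition B2 := th 1 2 10 * th (-1) 4 10.
Definition X2 := th 1 6 20 * th 1 8 20.
Definition Y2 := th 1 4 20 * th 1 2 20.

Lemma A2E : A2 = X2 + 'q ^+ 2 * Y2.
Proof. exact: (@th_mulN' 1 2 4 10). Qed.

Lemma B2E : B2 = X2 - 'q ^+ 2 * Y2.
Proof. exact: (@th_mulP' (-1) 2 4 10). Qed.

Lemma RR_sqrB : R ^+ 2 - Rt ^+ 2 = - (4%:R * ('q * (th_fac ^+ 2 * th_even * th_odd))).
Proof. by rewrite RR_decomp RRN_decomp; ring. Qed.

Lemma RR_subN : R - Rt = - (2%:R * ('q * (th_fac * th_odd))).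
Proof. by rewrite RR_decomp RRN_decomp; ring. Qed.

(** The argument t is the theta series that determines the residues; all other factors must combine
    to a series in q^5. *)
Ltac quot_solve t M := apply: (@supp_quot _ t _ _ M);
  [by apply: th_supp | by rewrite ?thP1 ?thPN | by pl_norm; reflexivity | by [] |
   by vm_compute].

Ltac even_solve := repeat match goal with
  | |- is_even (_ * _) => apply: is_evenM
  | |- is_even ((RR (- _))^-1) => apply: is_evenV; first by apply: RRNXn_unit
  | |- is_even ((RR _)^-1) => apply: is_evenV; first by apply: RRXn_unit
  | |- is_even (RR (- _)) => exact: neg_RRN_even
  | |- is_even (RR _) => exact: neg_RR_even
  | |- is_even (- _) => apply: is_evenN
  | |- is_even (_ ^+ _) => first [by apply: neg_evenX | apply: is_evenXn]
  end.

(** Up to a common factor the even parts of [lambda8] and its inverse are X2^2 and Y2^2, and X2^2 -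
    q^4 Y2^2 = A2 B2 is a single product. *)
Lemma lambda8_odd (F := lambda8 + 'q ^+ 4 * lambda8^-1) :
  F - neg F = - (4%:R * ('q * (th_fac ^+ 2 * th_even * th_odd *
    (A2 * B2 * (X2^-1 ^+ 2 * R4^-1 ^+ 3))))).
Proof.
have l1 : lambda8 = R ^+ 2 * R4^-1 ^+ 3 by rewrite /lambda8; pl_solve 20%N.
have l2 : lambda8^-1 = Rt ^+ 2 * (R2 ^+ 2 * R4) by rewrite /lambda8; pl_solve 20%N.
transitivity ((R ^+ 2 - Rt ^+ 2) * (R4^-1 ^+ 3 - 'q ^+ 4 * (R2 ^+ 2 * R4))).
  by apply: (odd_part neg_RR neg_RRN l1 l2); even_solve.
have e1 : R4^-1 ^+ 3 = X2 ^+ 2 * (X2^-1 ^+ 2 * R4^-1 ^+ 3) by rewrite /X2; pl_solve 20%N.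
have e2 : R2 ^+ 2 * R4 = Y2 ^+ 2 * (X2^-1 ^+ 2 * R4^-1 ^+ 3).
  by rewrite /X2 /Y2; pl_solve 20%N.
rewrite e2 A2E B2E.
move: (X2^-1 ^+ 2 * _) e1 => w ->.
by rewrite RR_sqrB; ring.
Qed.

Lemma lambda8_supp (F := lambda8 + 'q ^+ 4 * lambda8^-1) :
  supp [:: 1; 2; 3]%N (F - neg F).
Proof.
rewrite /F lambda8_odd -['q]expr1; apply/suppN/supp_natl.
apply: (@suppXn [:: 0; 1; 2]%N) => //.
by rewrite /th_fac /th_even /th_odd /A2 /B2 /X2; quot_solve (th (-1) 2 8) 80%N.
Qed.

Lemma lambda10_inv : lambda10^-1 = R / Rt.
Proof. by rewrite /lambda10; pl_solve 20%N. Qed.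

Lemma lambda10E : lambda10 = Rt / R.
Proof. by rewrite /lambda10; pl_solve 20%N. Qed.

Lemma lambda10_supp : supp [:: 0; 1; 4]%N (lambda10 - lambda10^-1).
Proof.
have l1 : lambda10 = Rt ^+ 2 * (R2 / R4) by rewrite /lambda10; pl_solve 20%N.
have l2 : lambda10^-1 = R ^+ 2 * (R2 / R4) by rewrite /lambda10; pl_solve 20%N.
have -> : lambda10 - lambda10^-1 = 4%:R * ('q ^+ 1 * (th_fac ^+ 2 * th_even * th_odd * (R2 / R4))).
  transitivity (Rt ^+ 2 * (R2 / R4) - R ^+ 2 * (R2 / R4)).
    exact: (congr2 (fun x y => x - y) l1 l2).
  by rewrite -mulrBl -opprB RR_sqrB; ring.
apply/supp_natl/(@suppXn [:: 0; 3; 4]%N) => //.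
by rewrite /th_fac /th_even /th_odd; quot_solve (th 1 4 12) 240%N.
Qed.

(** Up to a common factor the even parts are B2^2 and A2^2, with B2^2 - A2^2 = -4 q^2 X2 Y2. In the
    difference of fourth powers, r^2 + r'^2 = (r - r')^2 + 2 r r' leaves two products, each with its
    own theta series. *)
Lemma lambda7_supp (F := lambda7 + 1 * lambda7^-1) :
  supp [:: 0; 2; 3]%N (F - neg F).
Proof.
(* Stated for variables: rewriting with closed series would make unification
   compute them. *)
have alg (r r' t c x y X Y A B w f g : fps int) :
    f = B ^+ 2 * w -> g = A ^+ 2 * w ->
    A = X + t ^+ 2 * Y -> B = X - t ^+ 2 * Y ->
    r ^+ 2 - r' ^+ 2 = - (4%:R * (t * (c ^+ 2 * x * y))) ->
    r - r' = - (2%:R * (t * (c * y))) ->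
    (r' ^+ 4 - r ^+ 4) * (f - 1 * g) =
    - (64%:R * (t ^+ 5 * (c ^+ 4 * x * y ^+ 3 * (X * Y * w))) +
       32%:R * (t ^+ 3 * (c ^+ 2 * x * y * (r * r') * (X * Y * w)))).
  move=> -> -> -> -> e2 e1.
  transitivity (- ((r ^+ 2 - r' ^+ 2) * ((r - r') ^+ 2 + 2%:R * (r * r')) *
    (- (4%:R * (t ^+ 2 * (X * Y * w)))))); first by ring.
  by rewrite e2 e1; ring.
pose w := R2 ^+ 4 * B2^-1 ^+ 2 * R4^-1 ^+ 3.
have l1 : lambda7 = Rt ^+ 4 * (R2 ^+ 4 * R4^-1 ^+ 3) by rewrite /lambda7; pl_solve 20%N.
have l2 : lambda7^-1 = R ^+ 4 * R4^-1 by rewrite /lambda7; pl_solve 20%N.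
have -> : F - neg F = (Rt ^+ 4 - R ^+ 4) * (R2 ^+ 4 * R4^-1 ^+ 3 - 1 * R4^-1).
  have ev1 : is_even 1 by apply: (rmorph1 neg).
  by apply: (odd_part neg_RRN neg_RR l1 l2) => //; even_solve.
have e1 : R2 ^+ 4 * R4^-1 ^+ 3 = B2 ^+ 2 * w by rewrite /w /B2; pl_solve 20%N.
have e2 : R4^-1 = A2 ^+ 2 * w by rewrite /w /A2 /B2; pl_solve 20%N.
have -> : (Rt ^+ 4 - R ^+ 4) * (R2 ^+ 4 * R4^-1 ^+ 3 - 1 * R4^-1) =
    - (64%:R * ('q ^+ 5 * (th_fac ^+ 4 * th_even * th_odd ^+ 3 * (X2 * Y2 * w))) +
       32%:R * ('q ^+ 3 * (th_fac ^+ 2 * th_even * th_odd * (R * Rt) * (X2 * Y2 * w)))).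
  apply: alg e1 e2 A2E B2E RR_sqrB RR_subN.
apply/suppN/suppD; apply/supp_natl.
  apply: (@suppXn [:: 0; 2; 3]%N) => //.
  by rewrite /w /th_fac /th_even /th_odd /X2 /Y2 /B2; quot_solve (th 1 2 4) 80%N.
apply: (@suppXn [:: 0; 2; 4]%N) => //.
by rewrite /w /th_fac /th_even /th_odd /X2 /Y2 /B2; quot_solve (th 1 2 6) 240%N.
Qed.

(** * Theta identities of modulus 80 for (vi) and (ix) *)

Local Notation R16 := (RR ('q ^+ 16)).
Local Notation Rt4 := (RR (- 'q ^+ 4)).
Local Notation th80 a := (th (-1) a 80).

Lemma th_split_q2 : th 1 2 20 = th80 24 - 'q ^+ 2 * th80 16.
Proof. exact: (@th_splitP 2 20). Qed.

Lemma th_split_q6 : th 1 6 20 = th80 32 - 'q ^+ 6 * th80 8.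
Proof. exact: (@th_splitP 6 20). Qed.

Lemma th_split_q10 : th (-1) 10 20 = th80 40 + 'q ^+ 10 * th80 0.
Proof. exact: (@th_splitN 10 20). Qed.

Lemma th_mul_q24 : th 1 8 40 * th 1 16 40 = th80 24 * th80 32 - 'q ^+ 8 * (th80 16 * th80 8).
Proof. exact: (@th_mulP' 1 8 16 40). Qed.

Lemma th_sqr_q8 : th (-1) 8 40 ^+ 2 = th80 16 * th80 40 + 'q ^+ 8 * (th80 24 * th80 0).
Proof. exact: (@th_mulN' (-1) 8 8 40). Qed.

Lemma th_sqr_q16 : th (-1) 16 40 ^+ 2 = th80 32 * th80 40 + 'q ^+ 16 * (th80 8 * th80 0).
Proof. exact: (@th_mulN' (-1) 16 16 40). Qed.

Lemma th_sqr_q4 : th (-1) 4 40 ^+ 2 = th80 8 * th80 40 + 'q ^+ 4 * (th80 32 * th80 0).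
Proof. exact: (@th_mulN' (-1) 4 4 40). Qed.

Lemma th_sqr_q12 : th (-1) 12 40 ^+ 2 = th80 24 * th80 40 + 'q ^+ 12 * (th80 16 * th80 0).
Proof. exact: (@th_mulN' (-1) 12 12 40). Qed.

Definition th_prod := th (-1) 10 20 * (th 1 8 40 * th 1 16 40).

(** After dissection to modulus 80 the mixed terms cancel, and the rest factors as ([th80 40] + q^10
    [th80 0]) times the expansion in [th_mul_q24]. The identity for [lambda9] has the same right
    side. *)
Lemma lambda6_theta :
  th 1 2 20 * th (-1) 16 40 ^+ 2 + 'q ^+ 2 * (th 1 6 20 * th (-1) 8 40 ^+ 2) = th_prod.
Proof.
rewrite /th_prod th_split_q2 th_split_q6 th_split_q10 th_mul_q24 th_sqr_q8 th_sqr_q16.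
ring.
Qed.

Lemma lambda9_theta :
  th 1 6 20 * th (-1) 12 40 ^+ 2 + 'q ^+ 6 * (th 1 2 20 * th (-1) 4 40 ^+ 2) = th_prod.
Proof.
rewrite /th_prod th_split_q2 th_split_q6 th_split_q10 th_mul_q24 th_sqr_q4 th_sqr_q12.
ring.
Qed.

Lemma lambda6_supp (F := lambda6 + - 'q ^+ 2 * lambda6^-1) :
  supp [:: 1; 3; 4]%N (F - neg F).
Proof.
pose w := Rt4 / (th 1 6 20 * th (-1) 8 40 ^+ 2).
have l1 : lambda6 = R ^+ 1 * (R2 / R4 / Rt4) by rewrite /lambda6 div1r; pl_solve 80%N.
have l2 : lambda6^-1 = Rt ^+ 1 * Rt4 by rewrite /lambda6 div1r; pl_solve 80%N.
have e1 : R2 / R4 / Rt4 = th 1 2 20 * th (-1) 16 40 ^+ 2 * w by rewrite /w; pl_solve 80%N.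
have e2 : Rt4 = th 1 6 20 * th (-1) 8 40 ^+ 2 * w by rewrite /w; pl_solve 80%N.
have -> : F - neg F = - (2%:R * ('q ^+ 1 * (th_fac * th_odd * (th_prod * w)))).
  transitivity ((R ^+ 1 - Rt ^+ 1) * (R2 / R4 / Rt4 - - 'q ^+ 2 * Rt4)).
    by apply: (odd_part neg_RR neg_RRN l1 l2); even_solve.
  have alg (a b c t x y z g w' : fps int) : a - b = - (2%:R * (t * (c * y))) ->
      x + t ^+ 2 * g = z ->
      (a ^+ 1 - b ^+ 1) * (x * w' - - t ^+ 2 * (g * w')) =
      - (2%:R * (t ^+ 1 * (c * y * (z * w')))).
    by move=> ab <-; transitivity ((a - b) * (x + t ^+ 2 * g) * w');
      [ring | rewrite ab; ring].
  transitivity ((R ^+ 1 - Rt ^+ 1) * (th 1 2 20 * th (-1) 16 40 ^+ 2 * w -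
     - 'q ^+ 2 * (th 1 6 20 * th (-1) 8 40 ^+ 2 * w))).
    exact: (congr2 (fun x y => (R ^+ 1 - Rt ^+ 1) * (x - - 'q ^+ 2 * y)) e1 e2).
  exact: alg RR_subN lambda6_theta.
apply/suppN/supp_natl/(@suppXn [:: 0; 2; 3]%N) => //.
by rewrite /w /th_fac /th_odd /th_prod; quot_solve (th 1 8 16) 80%N.
Qed.

Lemma lambda9_supp (F := lambda9 + - 'q ^+ 6 * lambda9^-1) :
  supp [:: 0; 1; 3]%N (F - neg F).
Proof.
pose w := R16^-1 / (th 1 6 20 * th (-1) 12 40 ^+ 2).
have l1 : lambda9 = R ^+ 1 * R16^-1 by rewrite /lambda9; pl_solve 80%N.
have l2 : lambda9^-1 = Rt ^+ 1 * (R16 * R2 / R4) by rewrite /lambda9; pl_solve 80%N.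
have e1 : R16^-1 = th 1 6 20 * th (-1) 12 40 ^+ 2 * w by rewrite /w; pl_solve 80%N.
have e2 : R16 * R2 / R4 = th 1 2 20 * th (-1) 4 40 ^+ 2 * w by rewrite /w; pl_solve 80%N.
have -> : F - neg F = - (2%:R * ('q ^+ 1 * (th_fac * th_odd * (th_prod * w)))).
  transitivity ((R ^+ 1 - Rt ^+ 1) * (R16^-1 - - 'q ^+ 6 * (R16 * R2 / R4))).
    by apply: (odd_part neg_RR neg_RRN l1 l2); even_solve.
  have alg (a b c t x y z g w' : fps int) : a - b = - (2%:R * (t * (c * y))) ->
      x + t ^+ 6 * g = z ->
      (a ^+ 1 - b ^+ 1) * (x * w' - - t ^+ 6 * (g * w')) =
      - (2%:R * (t ^+ 1 * (c * y * (z * w')))).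
    by move=> ab <-; transitivity ((a - b) * (x + t ^+ 6 * g) * w');
      [ring | rewrite ab; ring].
  transitivity ((R ^+ 1 - Rt ^+ 1) * (th 1 6 20 * th (-1) 12 40 ^+ 2 * w -
     - 'q ^+ 6 * (th 1 2 20 * th (-1) 4 40 ^+ 2 * w))).
    exact: (congr2 (fun x y => (R ^+ 1 - Rt ^+ 1) * (x - - 'q ^+ 6 * y)) e1 e2).
  exact: alg RR_subN lambda9_theta.
apply/suppN/supp_natl/(@suppXn [:: 0; 2; 4]%N) => //.
by rewrite /w /th_fac /th_odd /th_prod; quot_solve (th 1 4 16) 80%N.
Qed.

Local Notation th10 a := (th (-1) a 10).

(** * Parts (iii) to (v) *)

(* [A1 / B1 = R2 / R ^+ 2] and [Y1 / X1 = R * R2 ^+ 2]. *)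
Definition X1 := th 1 3 10 * th 1 4 10.
Definition Y1 := th 1 2 10 * th 1 1 10.
Definition A1 := th (-1) 1 5 * th 1 2 5.
Definition B1 := th 1 1 5 * th (-1) 2 5.

Lemma A1E : A1 = X1 + 'q ^+ 1 * Y1.
Proof. exact: (@th_mulN' 1 1 2 5). Qed.

Lemma B1E : B1 = X1 - 'q ^+ 1 * Y1.
Proof. exact: (@th_mulP' (-1) 1 2 5). Qed.

Lemma th0_psi10 : th10 0 = 2%:R * th (-1) 10 40.
Proof. by rewrite thP0 //; congr (_ * _); pl_solve 80%N. Qed.

Lemma th0_psi20 : th (-1) 0 20 = 2%:R * th (-1) 20 80.
Proof. by rewrite thP0 //; congr (_ * _); pl_solve 160%N. Qed.

Lemma th0_psi4 : th (-1) 0 4 = 2%:R * th (-1) 4 16.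
Proof. by rewrite thP0 //; congr (_ * _); pl_solve 32%N. Qed.

Lemma natl_lreg k (f g : fps int) : k.+1%:R * f = k.+1%:R * g -> f = g.
Proof.
move=> e; apply: fpsP => n; have := congr1 (fun h : fps int => h n) e.
rewrite !fps_coef_natl => /mulfI; apply.
by rewrite pnatr_eq0.
Qed.

(** Twice the left side is A1^2 + B1^2. The squares of the four theta series have expansions of
    modulus 10 that differ only in signs, so half of the terms cancel. *)
Lemma sumsq1 : X1 ^+ 2 + 'q ^+ 2 * Y1 ^+ 2 =
  th10 5 ^+ 2 * (th10 2 * th10 4) - 4%:R * ('q ^+ 3 * (th (-1) 10 40 ^+ 2 * (th10 1 * th10 3))).
Proof.
have a1 : th (-1) 1 5 * th (-1) 1 5 = th10 2 * th10 5 + 'q ^+ 1 * (th10 3 * th10 0).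
  exact: (@th_mulN' (-1) 1 1 5).
have a2 : th 1 2 5 * th 1 2 5 = th10 4 * th10 5 - 'q ^+ 2 * (th10 1 * th10 0).
  exact: (@th_mulP' 1 2 2 5).
have b1 : th 1 1 5 * th 1 1 5 = th10 2 * th10 5 - 'q ^+ 1 * (th10 3 * th10 0).
  exact: (@th_mulP' 1 1 1 5).
have b2 : th (-1) 2 5 * th (-1) 2 5 = th10 4 * th10 5 + 'q ^+ 2 * (th10 1 * th10 0).
  exact: (@th_mulN' (-1) 2 2 5).
have alg (x y t u1 u2 v1 v2 c0 c1 c2 c3 c4 c5 d : fps int) :
  u1 * u2 = x + t ^+ 1 * y -> v1 * v2 = x - t ^+ 1 * y ->
  u1 * u1 = c2 * c5 + t ^+ 1 * (c3 * c0) -> u2 * u2 = c4 * c5 - t ^+ 2 * (c1 * c0) ->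
  v1 * v1 = c2 * c5 - t ^+ 1 * (c3 * c0) -> v2 * v2 = c4 * c5 + t ^+ 2 * (c1 * c0) ->
  c0 = 2%:R * d ->
  2%:R * (x ^+ 2 + t ^+ 2 * y ^+ 2) =
  2%:R * (c5 ^+ 2 * (c2 * c4) - 4%:R * (t ^+ 3 * (d ^+ 2 * (c1 * c3)))).
  move=> e1 e2 f1 f2 g1 g2 h.
  transitivity ((x + t ^+ 1 * y) ^+ 2 + (x - t ^+ 1 * y) ^+ 2); first by ring.
  rewrite -e1 -e2.
  transitivity ((u1 * u1) * (u2 * u2) + (v1 * v1) * (v2 * v2)); first by ring.
  by rewrite f1 f2 g1 g2 h; ring.
exact: natl_lreg (alg _ _ _ _ _ _ _ _ _ _ _ _ _ _ A1E B1E a1 a2 b1 b2 th0_psi10).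
Qed.

(** Up to the common factor k this is (E - q O) (E + q O) = E^2 - q^2 O^2, with E and O the series
    [th_even] and [th_odd]. *)
Lemma psi_norm5 : th10 2 * th10 4 = th (-1) 2 8 ^+ 2 - 'q ^+ 2 * th (-1) 10 40 ^+ 2.
Proof.
pose k := (th (-1) 2 8 / th_even) ^+ 2.
have e1 : th (-1) 2 8 ^+ 2 = k * th_even ^+ 2 by rewrite /k /th_even; pl_solve 80%N.
have e2 : th (-1) 10 40 ^+ 2 = k * th_odd ^+ 2 by rewrite /k /th_even /th_odd; pl_solve 80%N.
have e3 : th10 2 * th10 4 = k * ((th 1 1 10 * th (-1) 3 10) * (th (-1) 1 10 * th 1 3 10)).
  by rewrite /k /th_even; pl_solve 80%N.
have f1 : th 1 1 10 * th (-1) 3 10 = th_even - 'q ^+ 1 * th_odd.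
  exact: (@th_mulP (-1) 1 3 10).
have f2 : th (-1) 1 10 * th 1 3 10 = th_even + 'q ^+ 1 * th_odd.
  exact: (@th_mulN 1 1 3 10).
have alg (a b c k' x y t u v : fps int) : a = k' * x ^+ 2 -> b = k' * y ^+ 2 ->
    c = k' * (u * v) -> u = x - t ^+ 1 * y -> v = x + t ^+ 1 * y -> c = a - t ^+ 2 * b.
  by move=> -> -> -> -> ->; ring.
exact: alg e1 e2 e3 f1 f2.
Qed.

(* In Ramanujan's notation, [phi] is the sum of the [q^(n^2)] over the integers and
   [psi] that of the [q^(n(n-1)/2)] over the positive integers. *)
Definition psi2_phi5 := th (-1) 2 8 * th10 5.
Definition psi10_phi1 := th (-1) 10 40 * th (-1) 1 2.

(** Inserting [psi_norm5] into [sumsq1] leaves q^2 psi(q^10)^2 with a cofactor that [th_norm5]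
    recognizes as phi(q)^2. *)
Lemma sumsq1_diff : X1 ^+ 2 + 'q ^+ 2 * Y1 ^+ 2 = psi2_phi5 ^+ 2 - 'q ^+ 2 * psi10_phi1 ^+ 2.
Proof.
have alg (w a b c d e f t : fps int) :
    w = a ^+ 2 * b - 4%:R * (t ^+ 3 * (c ^+ 2 * d)) ->
    b = e ^+ 2 - t ^+ 2 * c ^+ 2 -> f ^+ 2 = a ^+ 2 + 4%:R * (t * d) ->
    w = (e * a) ^+ 2 - t ^+ 2 * (c * f) ^+ 2.
  by move=> -> -> f2; rewrite [(c * f) ^+ 2]exprMn f2; ring.
exact: alg sumsq1 psi_norm5 th_norm5.
Qed.

(** Once the common factor k is split off, all terms are polynomials in the four series
    [th (-1) a 20] with a = 2, 4, 6, 8. The right side, (q; q)_oo (q^5; q^5)_oo, is thus a factor of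
    the difference of squares in [sumsq1_diff]. *)
Lemma theta_diff : psi2_phi5 - 'q ^+ 1 * psi10_phi1 = th 1 1 3 * th 1 5 15.
Proof.
pose k := psi2_phi5 / (th10 2 * th10 4) ^+ 2.
have e1 : psi2_phi5 = k * (th10 2 * th10 4) ^+ 2 by rewrite /k /psi2_phi5; pl_solve 80%N.
have e2 : psi10_phi1 = k * (th10 1 * th10 3) ^+ 2.
  by rewrite /k /psi2_phi5 /psi10_phi1; pl_solve 80%N.
have e3 : th 1 1 3 * th 1 5 15 = k * ((th 1 1 10 * th 1 5 10) * (th 1 3 10 * th 1 5 10)).
  by rewrite /k /psi2_phi5; pl_solve 240%N.
have f1 : th10 2 * th10 4 = th (-1) 6 20 * th (-1) 8 20 + 'q ^+ 2 * (th (-1) 4 20 * th (-1) 2 20).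
  exact: (@th_mulN' (-1) 2 4 10).
have f2 : th10 1 * th10 3 = th (-1) 4 20 * th (-1) 8 20 + 'q ^+ 1 * (th (-1) 6 20 * th (-1) 2 20).
  exact: (@th_mulN' (-1) 1 3 10).
have f3 : th 1 1 10 * th 1 5 10 =
    th (-1) 6 20 * th (-1) 6 20 - 'q ^+ 1 * (th (-1) 4 20 * th (-1) 4 20).
  exact: (@th_mulP' 1 1 5 10).
have f4 : th 1 3 10 * th 1 5 10 =
    th (-1) 8 20 * th (-1) 8 20 - 'q ^+ 3 * (th (-1) 2 20 * th (-1) 2 20).
  exact: (@th_mulP' 1 3 5 10).
have alg (u w e k' a b c d l2 l4 l6 l8 t : fps int) :
   u = k' * a ^+ 2 -> w = k' * b ^+ 2 -> e = k' * (c * d) ->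
   a = l6 * l8 + t ^+ 2 * (l4 * l2) -> b = l4 * l8 + t ^+ 1 * (l6 * l2) ->
   c = l6 * l6 - t ^+ 1 * (l4 * l4) -> d = l8 * l8 - t ^+ 3 * (l2 * l2) ->
   u - t ^+ 1 * w = e.
  by move=> -> -> -> -> -> -> ->; ring.
exact: alg e1 e2 e3 f1 f2 f3 f4.
Qed.

Definition phi2 := th (-1) 2 4.
Definition psi4 := th (-1) 4 16.
Definition phi10 := th (-1) 10 20.
Definition psi20 := th (-1) 20 80.

Lemma theta_diff2 : psi4 * phi10 - 'q ^+ 2 * (psi20 * phi2) = th 1 2 6 * th 1 10 30.
Proof.
have := congr1 (fps_dilate 1) theta_diff.
rewrite /psi2_phi5 /psi10_phi1 (rmorphB (fps_dilate 1)) !(rmorphM (fps_dilate 1)) /= fps_dilateXn.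
by rewrite !th_dilate.
Qed.

(** Through psi(q)^2 = phi(q) psi(q^2) and phi(q)^2 = phi(q^2)^2 + 4 q psi(q^4)^2, the difference of
    squares acquires the left side of [theta_diff2] as a factor. Divided by A1 B1, the terms of this
    second form have the shape T(q) G(q^5); [lambda4], with denominator X1 Y1, uses the first
    form. *)
Lemma sumsq1_conj : X1 ^+ 2 + 'q ^+ 2 * Y1 ^+ 2 =
  (phi2 * phi10 - 4%:R * ('q ^+ 3 * (psi4 * psi20))) * (th 1 2 6 * th 1 10 30).
Proof.
have e1 : th (-1) 2 8 ^+ 2 = phi2 * psi4 by rewrite /phi2 /psi4; pl_solve 32%N.
have e2 : th (-1) 10 40 ^+ 2 = phi10 * psi20 by rewrite /phi10 /psi20; pl_solve 160%N.
have r20 : th (-1) 20 20 = th (-1) 0 20 by exact: (@th_refl (-1) 0 20).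
have e3 : th10 5 * th10 5 = phi10 * phi10 + 'q ^+ 5 * (th (-1) 0 20 * th (-1) 0 20).
  exact: (@th_mulN' (-1) 5 5 10).
have e4 : th (-1) 1 2 * th (-1) 1 2 = phi2 * phi2 + 'q ^+ 1 * (th (-1) 0 4 * th (-1) 0 4).
  exact: (@th_mulN' (-1) 1 1 2).
have alg (w a b c d e p5 p1 q2 q10 z20 z4 t : fps int) :
   w = (q2 * p5) ^+ 2 - t ^+ 2 * (q10 * p1) ^+ 2 ->
   b * c - t ^+ 2 * (d * a) = e ->
   q2 ^+ 2 = a * b -> q10 ^+ 2 = c * d ->
   p5 * p5 = c * c + t ^+ 5 * (z20 * z20) -> p1 * p1 = a * a + t ^+ 1 * (z4 * z4) ->
   z20 = 2%:R * d -> z4 = 2%:R * b ->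
   w = (a * c - 4%:R * (t ^+ 3 * (b * d))) * e.
  move=> -> <- f1 f2 f3 f4 f5 f6; rewrite !exprMn f1 f2 !expr2 f3 f4 f5 f6.
  by ring.
exact: alg sumsq1_diff theta_diff2 e1 e2 e3 e4 th0_psi20 th0_psi4.
Qed.

Lemma lambda3_supp : supp [:: 0; 2; 3]%N (lambda3 + lambda3^-1).
Proof.
pose w := A1^-1 * B1^-1.
have l1 : lambda3 = A1 ^+ 2 * w by rewrite /w /A1 /B1 /lambda3; pl_solve 10%N.
have l2 : lambda3^-1 = B1 ^+ 2 * w by rewrite /w /A1 /B1 /lambda3; pl_solve 10%N.
have alg (l l' x y t a b c d e v : fps int) : l = (x + t ^+ 1 * y) ^+ 2 * v ->
    l' = (x - t ^+ 1 * y) ^+ 2 * v ->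
    x ^+ 2 + t ^+ 2 * y ^+ 2 = (a * c - 4%:R * (t ^+ 3 * (b * d))) * e ->
    l + l' = 2%:R * (a * (c * e * v)) - 8%:R * (t ^+ 3 * (b * (d * e * v))).
  move=> -> -> h; transitivity (2%:R * (x ^+ 2 + t ^+ 2 * y ^+ 2) * v); first by ring.
  by rewrite h; ring.
rewrite A1E in l1; rewrite B1E in l2.
rewrite (alg _ _ _ _ _ _ _ _ _ _ _ l1 l2 sumsq1_conj).
apply/suppB; apply/supp_natl.
  by rewrite /w /phi2 /phi10 /A1 /B1; quot_solve (th (-1) 2 4) 120%N.
apply: (@suppXn [:: 0; 2; 4]%N) => //.
by rewrite /w /psi4 /psi20 /A1 /B1; quot_solve (th (-1) 4 16) 480%N.
Qed.

Lemma lambda4_supp : supp [:: 0; 1; 2]%N (lambda4 + 'q ^+ 2 * lambda4^-1).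
Proof.
pose w := X1^-1 * Y1^-1.
have l1 : lambda4 = X1 ^+ 2 * w by rewrite /w /X1 /Y1 /lambda4 div1r; pl_solve 10%N.
have l2 : lambda4^-1 = Y1 ^+ 2 * w by rewrite /w /X1 /Y1 /lambda4 div1r; pl_solve 10%N.
have alg (l l' x y t a b e v : fps int) : l = x ^+ 2 * v -> l' = y ^+ 2 * v ->
    x ^+ 2 + t ^+ 2 * y ^+ 2 = a ^+ 2 - t ^+ 2 * b ^+ 2 -> a - t ^+ 1 * b = e ->
    l + t ^+ 2 * l' = a * e * v + t ^+ 1 * (b * e * v).
  move=> -> -> h e1; transitivity ((x ^+ 2 + t ^+ 2 * y ^+ 2) * v); first by ring.
  by rewrite h -e1; ring.
rewrite (alg _ _ _ _ _ _ _ _ _ l1 l2 sumsq1_diff theta_diff).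
apply/suppD.
  by rewrite /w /psi2_phi5 /X1 /Y1; quot_solve (th (-1) 2 8) 240%N.
apply: (@suppXn [:: 0; 1; 4]%N) => //.
by rewrite /w /psi10_phi1 /X1 /Y1; quot_solve (th (-1) 1 2) 240%N.
Qed.

Lemma sumsq2_conj : X2 ^+ 2 + 'q ^+ 4 * Y2 ^+ 2 =
  (th (-1) 4 8 * th (-1) 20 40 - 4%:R * ('q ^+ 6 * (th (-1) 8 32 * th (-1) 40 160))) *
  (th 1 4 12 * th 1 20 60).
Proof.
have alg (phi : {rmorphism fps int -> fps int}) (x y t a b c d e : fps int) :
    x ^+ 2 + t ^+ 2 * y ^+ 2 = (a * c - 4%:R * (t ^+ 3 * (b * d))) * e ->
    phi x ^+ 2 + phi t ^+ 2 * phi y ^+ 2 =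
    (phi a * phi c - 4%:R * (phi t ^+ 3 * (phi b * phi d))) * phi e.
  move=> /(congr1 phi).
  by rewrite rmorphD !(rmorphXn, rmorphM, rmorphB, rmorph_nat).
have dM a b m n : (0 < m)%N -> (a <= m)%N -> (0 < n)%N -> (b <= n)%N ->
    fps_dilate 1 (th 1 a m * th 1 b n) = th 1 (2 * a) (2 * m) * th 1 (2 * b) (2 * n).
  by move=> *; rewrite (rmorphM (fps_dilate 1)) /= !th_dilate.
have := alg (fps_dilate 1) _ _ _ _ _ _ _ _ sumsq1_conj.
rewrite /X1 /Y1 /phi2 /psi4 /phi10 /psi20 /= !dM // !th_dilate // fps_dilateX -!exprM => e.
exact: e.
Qed.

(** Up to common factors F is (E + q O) X B - q^2 (E - q O) Y A, with E and O the even and odd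
    parts. The coefficient of E is A B - 2 q^2 X Y; that of q O is X^2 + q^4 Y^2, to which
    [sumsq2_conj] applies. *)
Lemma lambda5_supp : supp [:: 0; 1; 2]%N (lambda5 - 'q ^+ 2 * lambda5^-1).
Proof.
pose w := R2 * R4^-1 ^+ 2 * X2^-1 * B2^-1.
have l1 : lambda5 = Rt * (R2 * R4^-1 ^+ 2) by rewrite /lambda5 div1r; pl_solve 20%N.
have l2 : lambda5^-1 = R * R4 by rewrite /lambda5 div1r; pl_solve 20%N.
have e1 : R2 * R4^-1 ^+ 2 = X2 * B2 * w by rewrite /w /X2 /B2; pl_solve 20%N.
have e2 : R4 = Y2 * A2 * w by rewrite /w /X2 /Y2 /A2 /B2; pl_solve 20%N.
have alg (l l' f g r r' c x y t X Y A B v a' b' c' d' e : fps int) :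
    l = r' * f -> l' = r * g -> f = X * B * v -> g = Y * A * v ->
    r = c * (x - t * y) -> r' = c * (x + t * y) ->
    A = X + t ^+ 2 * Y -> B = X - t ^+ 2 * Y ->
    X ^+ 2 + t ^+ 4 * Y ^+ 2 = (a' * c' - 4%:R * (t ^+ 6 * (b' * d'))) * e ->
    l - t ^+ 2 * l' = c * x * (A * B) * v - 2%:R * (t ^+ 2 * (c * x * (X * Y) * v)) +
      t ^+ 1 * (a' * (c * y * v * c' * e)) - 4%:R * (t ^+ 7 * (b' * (c * y * v * d' * e))).
  move=> -> -> -> -> -> -> -> -> h.
  transitivity (c * x * ((X + t ^+ 2 * Y) * (X - t ^+ 2 * Y)) * v -
    2%:R * (t ^+ 2 * (c * x * (X * Y) * v)) +
    t ^+ 1 * (c * y * v * (X ^+ 2 + t ^+ 4 * Y ^+ 2))); first by ring.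
  by rewrite h; ring.
rewrite (alg _ _ _ _ _ _ _ _ _ _ _ _ _ _ _ _ _ _ _ _ l1 l2 e1 e2 RR_decomp RRN_decomp
  A2E B2E sumsq2_conj).
apply/suppB; last first.
  apply/supp_natl/(@suppXn [:: 0; 3; 4]%N) => //.
  by rewrite /w /th_fac /th_odd /X2 /B2; quot_solve (th (-1) 8 32) 960%N.
apply/suppD; last first.
  apply: (@suppXn [:: 0; 1; 4]%N) => //.
  by rewrite /w /th_fac /th_odd /X2 /B2; quot_solve (th (-1) 4 8) 240%N.
apply/suppB.
  by rewrite /w /th_fac /th_even /X2 /A2 /B2; quot_solve (th (-1) 2 8) 80%N.
apply/supp_natl/(@suppXn [:: 0; 3; 4]%N) => //.
by rewrite /w /th_fac /th_even /X2 /Y2 /B2; quot_solve (th 1 4 12) 240%N.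
Qed.

(** * Parts (i) and (ii) *)

Local Notation R5 := (RR ('q ^+ 5)).
Local Notation eu k := (qpoch ('q ^+ k) ('q ^+ k)).

Lemma eu_unit k : (0 < k)%N -> eu k \is a GRing.unit.
Proof. exact: qpochXn_unit. Qed.

(** In [euler_split5] two terms have exponents 0 modulo 5, two have 2, and one has 1. The quintuple
    product identity, for a = 5 and a = 10, sums the two pairs. *)
Lemma euler_RR : R5 * eu 1 = eu 25 * (1 - 'q * R5 - ('q * R5) ^+ 2).
Proof.
have l : th (-1) 5 25 * th 1 15 50 =
    th 1 50 150 * (th 1 40 75 + 'q ^+ 5 * th 1 65 75).
  exact: (@quintuple_low 5 25).
have h : th (-1) 10 25 * th 1 5 50 =
    th 1 50 150 * (th 1 55 75 - 'q ^+ 5 * th 1 5 75).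
  exact: (@quintuple_high 10 25).
have r35 : th 1 40 75 = th 1 35 75 by exact: (@th_refl 1 35 75).
have r20 : th 1 55 75 = th 1 20 75 by exact: (@th_refl 1 20 75).
have e50 : th 1 50 75 = eu 25 by rewrite qpochP; pl_solve 75%N.
have e1 : th 1 1 3 = eu 1 by rewrite qpochP; pl_solve 3%N.
have pl1 : R5 * (th (-1) 5 25 * th 1 15 50) = th 1 50 150 * eu 25.
  by rewrite qpochP; pl_solve 150%N.
have pl2 : th (-1) 10 25 * th 1 5 50 = th 1 50 150 * (eu 25 * R5).
  by rewrite qpochP; pl_solve 150%N.
have u : th 1 50 150 \is a GRing.unit by rewrite thP1 // pl_unit.
have alg (e e' r t a1 a2 b1 b2 b1' m m1 m2 x x' : fps int) : m \is a GRing.unit ->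
    m1 = m * (b1' + t ^+ 5 * a1) -> m2 = m * (x' - t ^+ 5 * a2) ->
    b1' = b1 -> x' = x -> b2 = e' -> r * m1 = m * e' -> m2 = m * (e' * r) ->
    e = b1 - t * b2 - t ^+ 2 * x + t ^+ 7 * a2 + t ^+ 5 * a1 ->
    r * e = e' * (1 - t * r - (t * r) ^+ 2).
  move=> mu -> -> -> -> -> f1 f2 ->.
  have g1 : r * (b1 + t ^+ 5 * a1) = e'.
    by apply: (mulrI mu); rewrite -f1; ring.
  have g2 : x - t ^+ 5 * a2 = e' * r by apply: (mulrI mu).
  transitivity (r * (b1 + t ^+ 5 * a1) - t * r * e' - t ^+ 2 * r * (x - t ^+ 5 * a2)).
    by ring.
  by rewrite g1 g2; ring.
have es := euler_split5; rewrite e1 in es.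
exact: alg u l h r35 r20 e50 pl1 pl2 es.
Qed.

(** (q; q)_oo is cut into (q^r; q^5)_oo for r = 1, ..., 5. The norm of such a factor is (q^(5r);
    q^25)_oo for r < 5 and its fifth power for r = 5. *)
Lemma euler_norm5 (F : comNzRingType) (w : F) (X := fpsX F) :
  1 + w + w ^+ 2 + w ^+ 3 + w ^+ 4 = 0 ->
  (\prod_(j < 5) fps_scale (w ^+ j) (qpoch X X)) * qpoch (X ^+ 25) (X ^+ 25) =
  qpoch (X ^+ 5) (X ^+ 5) ^+ 6.
Proof.
move=> w0; have w5 := fifth_root_exp5 w0.
have X0 : X 0%N = 0 by [].
have Xn0 n : (0 < n)%N -> (X ^+ n) 0%N = 0.
  by move=> n0; rewrite fps_coef0X X0 expr0n eqn0Ngt n0.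
pose W := fps_const w.
have Wscale j r : fps_scale (w ^+ j) (X ^+ r) = (W ^+ r) ^+ j * X ^+ r.
  rewrite (rmorphXn (fps_scale (w ^+ j))) /= fps_scale_X exprMn.
  by rewrite (rmorphXn (@fps_const F)) /= -!exprM mulnC.
have W5 : W ^+ 5 = 1.
  by rewrite -(rmorphXn (@fps_const F)) w5; apply: (rmorph1 (@fps_const F)).
have conj r : \prod_(j < 5) fps_scale (w ^+ j) (qpoch (X ^+ r) (X ^+ 5)) =
    \prod_(j < 5) qpoch ((W ^+ r) ^+ j * X ^+ r) (X ^+ 5).
  apply: eq_bigr => j _; rewrite qpoch_scale !Wscale.
  by rewrite W5 expr1n mul1r.
have W0 : 1 + W + W ^+ 2 + W ^+ 3 + W ^+ 4 = 0.
  rewrite -!(rmorphXn (@fps_const F)) -(rmorph1 (@fps_const F)) -!(rmorphD (@fps_const F)).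
  by rewrite w0; apply: (rmorph0 (@fps_const F)).
have norm r : (0 < r < 5)%N -> \prod_(j < 5) fps_scale (w ^+ j) (qpoch (X ^+ r) (X ^+ 5)) =
    qpoch (X ^+ (5 * r)) (X ^+ 25).
  (* W^r is again a primitive fifth root: reducing exponents modulo 5 permutes the terms of the
     cyclotomic sum. *)
  move=> r5; suff wr : 1 + W ^+ r + (W ^+ r) ^+ 2 + (W ^+ r) ^+ 3 + (W ^+ r) ^+ 4 = 0.
    rewrite conj (qpoch_fifth_roots _ (Xn0 5%N isT) wr) -!exprM.
    by rewrite [(r * 5)%N]mulnC.
  move: W5 W0 {conj Wscale}; move: W => u u5 u0.
  case: r r5 => [|[|[|[|[|r]]]]] // _.
  - transitivity (1 + u ^+ 2 + u ^+ 4 + u ^+ 5 * u + u ^+ 5 * u ^+ 3); first by ring.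
    by rewrite u5; transitivity (1 + u + u ^+ 2 + u ^+ 3 + u ^+ 4); [ring | exact: u0].
  - transitivity (1 + u ^+ 3 + u ^+ 5 * u + u ^+ 5 * u ^+ 4 + u ^+ 5 * u ^+ 5 * u ^+ 2).
      by ring.
    by rewrite u5; transitivity (1 + u + u ^+ 2 + u ^+ 3 + u ^+ 4); [ring | exact: u0].
  - transitivity (1 + u ^+ 4 + u ^+ 5 * u ^+ 3 + u ^+ 5 * u ^+ 5 * u ^+ 2 +
      u ^+ 5 * u ^+ 5 * u ^+ 5 * u); first by ring.
    by rewrite u5; transitivity (1 + u + u ^+ 2 + u ^+ 3 + u ^+ 4); [ring | exact: u0].
have split m : (0 < m)%N -> qpoch (X ^+ m) (X ^+ m) =
    \prod_(r < 5) qpoch (X ^+ (m * r.+1)) (X ^+ (m * 5)).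
  move=> m0; rewrite (qpochM _ (Xn0 m m0) (isT : (0 < 5)%N)) -exprM.
  by apply: eq_bigr => r _; rewrite -exprM -exprD -(mulnS m r).
have -> : qpoch X X = \prod_(r < 5) qpoch (X ^+ (1 * r.+1)) (X ^+ (1 * 5)).
  exact: (split 1%N isT).
under eq_bigr => j _ do rewrite (rmorph_prod (fps_scale (w ^+ j))).
rewrite exchange_big /=.
rewrite big_ord_recr !mul1n /=.
have -> : \prod_(j < 5) fps_scale (w ^+ j) (qpoch (X ^+ 5) (X ^+ 5)) =
    qpoch (X ^+ 5) (X ^+ 5) ^+ 5.
  rewrite conj W5 (eq_bigr (fun=> qpoch (X ^+ 5) (X ^+ 5))) ?prodr_const ?card_ord //.
  by move=> j _; rewrite expr1n mul1r.
rewrite (eq_bigr (fun r : 'I_4 => qpoch (X ^+ (5 * r.+1)) (X ^+ 25))); last first.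
  by move=> r _; rewrite mul1n; apply: norm; apply: (ltn_ord r).
have e : qpoch (X ^+ 5) (X ^+ 5) = (\prod_(r < 4) qpoch (X ^+ (5 * r.+1)) (X ^+ 25)) *
    qpoch (X ^+ 25) (X ^+ 25).
  by rewrite {1}(split 5%N isT) big_ord_recr.
by rewrite mulrAC -e -exprS.
Qed.

Lemma R5_dilate : R5 = fps_dilate 4 R.
Proof.
have e : fps_dilate 4 'q = 'q ^+ 5 by exact: (fps_dilateX int 4).
have q0 : 'q 0%N = 0 by rewrite -['q]expr1 coef0Xn.
by rewrite (RR_dilate 4 q0) e.
Qed.

Lemma eu_dilate k j : (0 < j)%N -> eu (k.+1 * j) = fps_dilate k (eu j).
Proof. by move=> j0; rewrite (qpoch_dilate _ _ (coef0Xn j0)) !fps_dilateXn. Qed.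

(* The product of [euler_RR] over the substitutions [q -> w^j q], where [w] is a
   primitive fifth root of unity. *)
Lemma RR_norm5 :
  R5 ^+ 5 * eu 5 ^+ 6 = eu 25 ^+ 6 * (1 - 11%:R * ('q * R5) ^+ 5 - ('q * R5) ^+ 10).
Proof.
(* The product over conjugates is formed over [algC]; the injectivity of [phi] brings the final
   identity back to the integers. *)
have [w w0] := algC_fifth_root.
have w5 := fifth_root_exp5 w0.
pose phi : {rmorphism fps int -> fps algC} := fps_map (intr : {rmorphism int -> algC}).
pose sc (j : nat) : {rmorphism fps algC -> fps algC} := fps_scale (w ^+ j).
pose W := fps_const w.
have W0 : 1 + W + W ^+ 2 + W ^+ 3 + W ^+ 4 = 0.
  rewrite -!(rmorphXn (@fps_const algC)) -(rmorph1 (@fps_const algC)).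
  by rewrite -!(rmorphD (@fps_const algC)) w0; apply: (rmorph0 (@fps_const algC)).
have wj5 (j : nat) : (w ^+ j) ^+ 5 = 1 by rewrite -exprM mulnC exprM w5 expr1n.
have sc_dil j f : sc j (phi (fps_dilate 4 f)) = phi (fps_dilate 4 f).
  by rewrite /phi /= fps_map_dilate; apply: fps_scale_dilate.
have phiXn n : phi ('q ^+ n) = fpsX algC ^+ n.
  by rewrite (rmorphXn phi); congr (_ ^+ n); apply: fps_mapX.
have phi_eu n : phi (eu n) = qpoch (fpsX algC ^+ n) (fpsX algC ^+ n).
  by rewrite -!phiXn; apply: qpoch_map.
have norm := @euler_norm5 algC w w0.
rewrite -[X in qpoch (X ^+ 5)]expr1 in norm.
have scX j : sc j (phi 'q) = W ^+ j * phi 'q.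
  rewrite -[phi 'q]/(fps_map _ 'q) fps_mapX; apply: etrans (fps_scale_X _) _.
  by rewrite (rmorphXn (@fps_const algC)).
have alg (A B : comNzRingType) (psi : {rmorphism A -> B}) (r e e' t : A) :
    r * e = e' * (1 - t * r - (t * r) ^+ 2) ->
    psi r * psi e = psi e' * (1 - psi t * psi r - (psi t * psi r) ^+ 2).
  move=> /(congr1 psi).
  by rewrite !(rmorphM psi, rmorphB psi, rmorphXn psi, rmorph1 psi).
have alg5 (A : comNzRingType) (psi : {rmorphism fps int -> A}) (r e e' t : fps int) :
    psi r ^+ 5 * psi e ^+ 6 =
      psi e' ^+ 6 * (1 - 11%:R * (psi t * psi r) ^+ 5 - (psi t * psi r) ^+ 10) ->
    psi (r ^+ 5 * e ^+ 6) = psi (e' ^+ 6 * (1 - 11%:R * (t * r) ^+ 5 - (t * r) ^+ 10)).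
  by rewrite !(rmorphM psi, rmorphB psi, rmorphXn psi, rmorph_nat psi, rmorph1 psi).
have scR j : sc j (phi R5) = phi R5 by rewrite R5_dilate; apply: sc_dil.
have scE j : sc j (phi (eu 25)) = phi (eu 25).
  by rewrite (@eu_dilate 4 5 isT); apply: sc_dil.
have key j : phi R5 * sc j (phi (eu 1)) =
    phi (eu 25) * (1 - W ^+ j * (phi 'q * phi R5) - (W ^+ j * (phi 'q * phi R5)) ^+ 2).
  have fin (r r' e e1 e1' t t' z : fps algC) : r' = r -> e1' = e1 -> t' = z * t ->
      r' * e = e1' * (1 - t' * r' - (t' * r') ^+ 2) ->
      r * e = e1 * (1 - z * (t * r) - (z * (t * r)) ^+ 2).
    by move=> -> -> ->; rewrite mulrA.
  exact: fin (scR j) (scE j) (scX j) (alg _ _ (sc j) _ _ _ _ (alg _ _ phi _ _ _ _ euler_RR)).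
have prod_key : phi R5 ^+ 5 * \prod_(j < 5) sc j (phi (eu 1)) =
    phi (eu 25) ^+ 5 * (1 - 11%:R * (phi 'q * phi R5) ^+ 5 - (phi 'q * phi R5) ^+ 10).
  have fin (r e' t : fps algC) (e : 'I_5 -> fps algC) :
      (forall j : 'I_5, r * e j = e' * (1 - W ^+ j * t - (W ^+ j * t) ^+ 2)) ->
      r ^+ 5 * \prod_j e j = e' ^+ 5 * (1 - 11%:R * t ^+ 5 - t ^+ 10).
    move=> eq_e; rewrite -(prod_golden _ W0).
    have cst (x : fps algC) : x ^+ 5 = \prod_(j < 5) x by rewrite prodr_const card_ord.
    by rewrite !cst -!big_split; apply: eq_bigr => j _; apply: eq_e.
  by apply: fin => j; apply: key.
apply: fps_map_intr_inj; apply: (alg5 _ phi).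
have fin (r e' P s5 x : fps algC) : P * e' = s5 ^+ 6 -> r ^+ 5 * P = e' ^+ 5 * x ->
    r ^+ 5 * s5 ^+ 6 = e' ^+ 6 * x.
  by move=> <- eq_r; rewrite mulrA eq_r exprSr; ring.
have norm' : \prod_(j < 5) sc j (phi (eu 1)) * phi (eu 25) = phi (eu 5) ^+ 6.
  have fin' (P P' a a' b b' : fps algC) : P' * a' = b' ^+ 6 -> P = P' -> a = a' ->
    b = b' -> P * a = b ^+ 6 by move=> + -> -> ->.
  apply: (fin' _ _ _ _ _ _ norm _ (phi_eu 25%N) (phi_eu 5%N)).
  by apply: eq_bigr => j _; exact: (congr1 (sc j) (phi_eu 1%N)).
exact: (fin _ _ _ _ _ norm' prod_key).
Qed.

(** Both sides of [RR_norm5] are series in q^5, in which q^5 may be replaced with q. *)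
Lemma RR_pow5 :
  R ^+ 5 * eu 1 ^+ 6 = eu 5 ^+ 6 * (1 - 11%:R * ('q * R ^+ 5) - ('q * R ^+ 5) ^+ 2).
Proof.
apply: (@fps_dilate_inj _ 4).
have alg (psi : {rmorphism fps int -> fps int}) (r e e' t r' e1 e1' : fps int) :
    psi t = t ^+ 5 -> psi r = r' -> psi e = e1 -> psi e' = e1' ->
    r' ^+ 5 * e1 ^+ 6 = e1' ^+ 6 * (1 - 11%:R * (t * r') ^+ 5 - (t * r') ^+ 10) ->
    psi (r ^+ 5 * e ^+ 6) = psi (e' ^+ 6 * (1 - 11%:R * (t * r ^+ 5) - (t * r ^+ 5) ^+ 2)).
  rewrite !(rmorphM psi, rmorphB psi, rmorphXn psi, rmorph_nat psi, rmorph1 psi).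
  by move=> -> -> -> -> ->; ring.
have e : fps_dilate 4 'q = 'q ^+ 5 by exact: (fps_dilateX int 4).
exact: (alg (fps_dilate 4) _ _ _ _ _ _ _ e (esym R5_dilate)
  (esym (@eu_dilate 4 1 isT)) (esym (@eu_dilate 4 5 isT)) RR_norm5).
Qed.

Lemma unit_1qM f : 1 + 'q * f \is a GRing.unit.
Proof.
have q0 : 'q 0%N = 0 by rewrite -['q]expr1 coef0Xn.
by rewrite fps_unitE fps_coefD fps_coef0M q0 mul0r addr0 fps_coef1 unitr1.
Qed.

(* Dividing out Euler products, [R ^+ 5] becomes a root of a quadratic equation
   whose other root is not a power series. *)
Lemma RR_quintic (v := 'q * R5) :
  R ^+ 5 * (1 + 3%:R * v + 4%:R * v ^+ 2 + 2%:R * v ^+ 3 + v ^+ 4) =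
  R5 * (1 - 2%:R * v + 4%:R * v ^+ 2 - 3%:R * v ^+ 3 + v ^+ 4).
Proof.
have alg (r s e1 e5 e25 u g a b : fps int) : u = 'q * s -> g = 1 - u - u ^+ 2 ->
    a = 1 + 3%:R * u + 4%:R * u ^+ 2 + 2%:R * u ^+ 3 + u ^+ 4 ->
    b = 1 - 2%:R * u + 4%:R * u ^+ 2 - 3%:R * u ^+ 3 + u ^+ 4 ->
    e25 \is a GRing.unit -> s * e1 = e25 * g ->
    s ^+ 5 * e5 ^+ 6 = e25 ^+ 6 * (1 - 11%:R * u ^+ 5 - u ^+ 10) ->
    r * e1 ^+ 6 = e5 ^+ 6 * (1 - 11%:R * ('q * r) - ('q * r) ^+ 2) ->
    r * a = s * b.
  move=> uE gE aE bE e25u h1 h2 h3.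
  have gu : g \is a GRing.unit.
    have -> : g = 1 + 'q * (- s - s * u) by rewrite gE uE; ring.
    exact: unit_1qM.
  (* Since u = q s, the quadratic equation for r reads (r a - s b) (a + q^2 s r b) = 0. The second
     factor has constant term 1 and can be cancelled. *)
  have wu : a + 'q ^+ 2 * s * r * b \is a GRing.unit.
    have -> : a + 'q ^+ 2 * s * r * b = 1 + 'q * (s * (3%:R + 4%:R * u + 2%:R * u ^+ 2 + u ^+ 3) +
       'q * s * r * b) by rewrite aE uE; ring.
    exact: unit_1qM.
  have g5 : g ^+ 5 = a ^+ 2 - 11%:R * u * a * b - u ^+ 2 * b ^+ 2.
    by rewrite gE aE bE; ring.
  (* The right side is the norm of g = 1 - u - u^2 over the fifth roots of unity, so a b is the
     product of the other four conjugates of g. *)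
  have gab : g * a * b = 1 - 11%:R * u ^+ 5 - u ^+ 10 by rewrite gE aE bE; ring.
  have e : r * g ^+ 5 = s * a * b * (1 - 11%:R * ('q * r) - ('q * r) ^+ 2).
    have U : e25 ^+ 6 * g \is a GRing.unit by rewrite unitrM unitrX.
    apply: (mulrI U); transitivity (r * (e25 * g) ^+ 6); first by ring.
    rewrite -h1; transitivity (s ^+ 6 * (r * e1 ^+ 6)); first by ring.
    rewrite h3; transitivity (s * (1 - 11%:R * ('q * r) - ('q * r) ^+ 2) * (s ^+ 5 * e5 ^+ 6)).
      by ring.
    by rewrite h2 -gab; ring.
  apply: (mulrI wu); apply/eqP; rewrite -subr_eq0; apply/eqP.
  transitivity (r * g ^+ 5 - s * a * b * (1 - 11%:R * ('q * r) - ('q * r) ^+ 2)).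
    by rewrite g5 uE; ring.
  by rewrite e subrr.
exact: (alg _ _ _ _ _ _ _ _ _ erefl erefl erefl erefl (@eu_unit 25 isT)
  euler_RR RR_norm5 RR_pow5).
Qed.

Lemma supp_in_q5_quot (S : seq nat) h f g :
  supp S h -> in_q5 g -> g \is a GRing.unit -> f * g = h -> supp S f.
Proof.
move=> hS g5 gu e; have -> : f = h * g ^ (-1) by rewrite -e mulrK.
by apply: suppM5 hS _; apply: in_q5_exprz.
Qed.

Lemma in_q5X f n : in_q5 f -> in_q5 (f ^+ n).
Proof. by move=> [g ->]; exists (g ^+ n); rewrite (rmorphXn (fps_dilate 4)). Qed.

Lemma supp_qMXn (S : seq nat) f k : in_q5 f -> (k %% 5)%N \in S -> supp S (('q * f) ^+ k).
Proof.
move=> f5 kS; rewrite exprMn; apply: suppM5; last exact: in_q5X.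
by move=> n nS; rewrite fps_coefXn; case: eqP nS => // ->; rewrite kS.
Qed.

Lemma in_q5_golden f : in_q5 f -> in_q5 (1 - 11%:R * ('q * f) ^+ 5 - ('q * f) ^+ 10).
Proof.
move=> [g ->]; exists (1 - 11%:R * ('q * g ^+ 5) - ('q * g ^+ 5) ^+ 2).
have e : fps_dilate 4 'q = 'q ^+ 5 by exact: (fps_dilateX int 4).
have alg (psi : {rmorphism fps int -> fps int}) (t h : fps int) : psi t = t ^+ 5 ->
    1 - 11%:R * (t * psi h) ^+ 5 - (t * psi h) ^+ 10 =
    psi (1 - 11%:R * (t * h ^+ 5) - (t * h ^+ 5) ^+ 2).
  rewrite !(rmorphM psi, rmorphB psi, rmorphXn psi, rmorph_nat psi, rmorph1 psi).
  by move=> ->; ring.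
exact: (alg (fps_dilate 4) _ _ e).
Qed.

Lemma unit_golden f : 1 - 11%:R * ('q * f) ^+ 5 - ('q * f) ^+ 10 \is a GRing.unit.
Proof.
have -> : 1 - 11%:R * ('q * f) ^+ 5 - ('q * f) ^+ 10 =
    1 + 'q * (- 11%:R * f * ('q * f) ^+ 4 - f * ('q * f) ^+ 9) by ring.
exact: unit_1qM.
Qed.

Lemma R5_in_q5 : in_q5 R5. Proof. by exists R; apply: R5_dilate. Qed.

(** With s = R(q^5), [RR_quintic] says R^5 = s b / a, so F = a / (s b) + q^2 s b / a. Multiplication
    by s and by D = (1 - u - u^2) a b, both series in q^5, gives h = (1 - u - u^2) (a^2 + u^2 b^2),
    in which only powers u^k with k = 0, 1, 2 modulo 5 survive. *)
Lemma lambda1_supp : supp [:: 0; 1; 2] (lambda1 + 'q ^+ 2 * lambda1^-1).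
Proof.
have alg (r s u : fps int) : in_q5 s -> s \is a GRing.unit -> r \is a GRing.unit ->
    u = 'q * s ->
    r * (1 + 3%:R * u + 4%:R * u ^+ 2 + 2%:R * u ^+ 3 + u ^+ 4) =
    s * (1 - 2%:R * u + 4%:R * u ^+ 2 - 3%:R * u ^+ 3 + u ^+ 4) ->
    supp [:: 0; 1; 2] (1 / r + 'q ^+ 2 * (1 / r)^-1).
  move=> s5 su ru uE rE; rewrite mul1r invrK.
  pose D := 1 - 11%:R * u ^+ 5 - u ^+ 10.
  have D5 : in_q5 D by rewrite /D uE; apply: in_q5_golden.
  have Du : D \is a GRing.unit by rewrite /D uE; apply: unit_golden.
  have uX k : (k %% 5)%N \in [:: 0; 1; 2]%N -> supp [:: 0; 1; 2] (u ^+ k).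
    by rewrite uE; apply: supp_qMXn.
  pose h := u ^+ 0 + 5%:R * u ^+ 1 + 11%:R * u ^+ 2 - 66%:R * u ^+ 5 - 66%:R * u ^+ 7 -
    11%:R * u ^+ 10 + 5%:R * u ^+ 11 - u ^+ 12.
  have hS : supp [:: 0; 1; 2] h.
    by rewrite /h; do ?[apply: suppD | apply: suppN | apply: supp_natl]; apply: uX.
  apply: (supp_in_q5_quot hS (in_q5M s5 D5)); first by rewrite unitrM su.
  move: ru => /mulVr; move: r^-1 => r' r'r.
  pose a := 1 + 3%:R * u + 4%:R * u ^+ 2 + 2%:R * u ^+ 3 + u ^+ 4.
  pose b := 1 - 2%:R * u + 4%:R * u ^+ 2 - 3%:R * u ^+ 3 + u ^+ 4.
  rewrite -[RHS]/h; transitivity ((1 - u - u ^+ 2) * a * (r' * (s * b)) +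
      (1 - u - u ^+ 2) * b * 'q ^+ 2 * s * (r * a)); first by rewrite /a /b /D; ring.
  have -> : r' * (s * b) = a by rewrite -rE mulrA r'r mul1r.
  have -> : r * a = s * b by [].
  transitivity ((1 - u - u ^+ 2) * (a ^+ 2 + ('q * s) ^+ 2 * b ^+ 2)); first by ring.
  by rewrite -uE /a /b /h; ring.
exact: (alg _ _ _ R5_in_q5 (@RRXn_unit 5 isT) (unitrX 5 (@RRXn_unit 1 isT)) erefl RR_quintic).
Qed.

(** Here F = b / a - a / b, and D F = (1 - u - u^2) (b^2 - a^2) contains no u^k with k divisible by
    5. *)
Lemma lambda2_supp : supp [:: 1; 2; 3; 4] (lambda2 - lambda2^-1).
Proof.
have alg (r s u : fps int) : in_q5 s -> s \is a GRing.unit -> r \is a GRing.unit ->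
    u = 'q * s ->
    r * (1 + 3%:R * u + 4%:R * u ^+ 2 + 2%:R * u ^+ 3 + u ^+ 4) =
    s * (1 - 2%:R * u + 4%:R * u ^+ 2 - 3%:R * u ^+ 3 + u ^+ 4) ->
    supp [:: 1; 2; 3; 4] (r / s - (r / s)^-1).
  move=> s5 su ru uE rE; rewrite invrM ?unitrV // invrK.
  pose D := 1 - 11%:R * u ^+ 5 - u ^+ 10.
  have D5 : in_q5 D by rewrite /D uE; apply: in_q5_golden.
  have Du : D \is a GRing.unit by rewrite /D uE; apply: unit_golden.
  have uX k : (k %% 5)%N \in [:: 1; 2; 3; 4]%N -> supp [:: 1; 2; 3; 4] (u ^+ k).
    by rewrite uE; apply: supp_qMXn.
  pose h := - (10%:R * u ^+ 1) + 5%:R * u ^+ 2 - 35%:R * u ^+ 3 + 55%:R * u ^+ 4 +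
    55%:R * u ^+ 6 + 35%:R * u ^+ 7 + 5%:R * u ^+ 8 + 10%:R * u ^+ 9.
  have hS : supp [:: 1; 2; 3; 4] h.
    by rewrite /h; do ?[apply: suppD | apply: suppN | apply: supp_natl]; apply: uX.
  apply: (supp_in_q5_quot hS D5 Du).
  move: ru su => /mulVr; move: r^-1 => r' r'r /mulVr; move: s^-1 => s' s's.
  pose a := 1 + 3%:R * u + 4%:R * u ^+ 2 + 2%:R * u ^+ 3 + u ^+ 4.
  pose b := 1 - 2%:R * u + 4%:R * u ^+ 2 - 3%:R * u ^+ 3 + u ^+ 4.
  rewrite -[RHS]/h; transitivity ((1 - u - u ^+ 2) * b * (s' * (r * a)) -
      (1 - u - u ^+ 2) * a * (r' * (s * b))); first by rewrite /a /b /D; ring.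
  have -> : r' * (s * b) = a by rewrite -rE mulrA r'r mul1r.
  have -> : s' * (r * a) = b by rewrite rE mulrA s's mul1r.
  by rewrite /a /b /h; ring.
exact: (alg _ _ _ R5_in_q5 (@RRXn_unit 5 isT) (unitrX 5 (@RRXn_unit 1 isT)) erefl RR_quintic).
Qed.

(** * From supports to coefficients *)

Lemma supp_coef0 (S : seq nat) f n r : supp S f -> r \notin S -> (n %% 5 = r)%N ->
  f n = 0.
Proof. by move=> fS rS nr; apply: fS; rewrite nr. Qed.

Lemma supp_coefD (S : seq nat) s (f g : fps int) n r : supp S (f + 'q ^+ s * g) ->
  r \notin S -> (n %% 5 = r)%N -> (s <= n)%N -> f n = - g (n - s)%N.
Proof.
move=> fgS rS nr le_sn; have := supp_coef0 fgS rS nr.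
by rewrite fps_coefD fps_coefXnM ltnNge le_sn => /eqP; rewrite addr_eq0 => /eqP.
Qed.

Lemma supp_coefB (S : seq nat) s (f g : fps int) n r : supp S (f - 'q ^+ s * g) ->
  r \notin S -> (n %% 5 = r)%N -> (s <= n)%N -> f n = g (n - s)%N.
Proof.
by rewrite -mulrN => fgS rS nr le_sn; rewrite (supp_coefD fgS rS nr le_sn) opprK.
Qed.

Lemma supp_odd (S : seq nat) (f : fps int) n r : supp S (f - neg f) ->
  r \notin S -> (n %% 5 = r)%N -> odd n -> f n = 0.
Proof.
move=> fS rS nr n_odd; have := supp_coef0 fS rS nr.
rewrite fps_coefD fps_coefN neg_coef -signr_odd n_odd expr1 mulN1r opprK.
have alg (x : int) : x + x = 0 -> x = 0 by lia.
exact: alg.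
Qed.

Lemma odd_coefD (S : seq nat) s (f g : fps int) (F := f + 'q ^+ s * g) n r :
  supp S (F - neg F) -> r \notin S -> (n %% 5 = r)%N -> odd n -> (s <= n)%N ->
  f n = - g (n - s)%N.
Proof.
move=> FS rS nr n_odd le_sn; have := supp_odd FS rS nr n_odd; rewrite /F.
by rewrite fps_coefD fps_coefXnM ltnNge le_sn => /eqP; rewrite addr_eq0 => /eqP.
Qed.

Lemma odd_coefB (S : seq nat) s (f g : fps int) (F := f + - 'q ^+ s * g) n r :
  supp S (F - neg F) -> r \notin S -> (n %% 5 = r)%N -> odd n -> (s <= n)%N ->
  f n = g (n - s)%N.
Proof.
rewrite /F mulNr -mulrN => FS rS nr n_odd le_sn.
by rewrite (odd_coefD FS rS nr n_odd le_sn) opprK.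
Qed.

Lemma lambda10_neg : lambda10 = neg lambda10^-1.
Proof.
have alg (x y r s : fps int) : x = s / r -> y = r / s -> neg r = s -> neg s = r ->
    s \is a GRing.unit -> x = neg y.
  move=> -> -> rs sr su; rewrite (rmorphM neg) /= (rmorphV neg su) /=.
  by rewrite rs sr.
have Rtu : RR (- 'q) \is a GRing.unit.
  by apply: RR_unit; rewrite fps_coefN -['q]expr1 coef0Xn // oppr0.
exact: alg lambda10E lambda10_inv neg_RR neg_RRN Rtu.
Qed.

Theorem theorem1p4 (n : nat) :
  (forall r : nat, r \in [:: 3; 4]%N ->
     lambda1 (5 * n + r)%N = - (lambda1^-1) (5 * n + r - 2)%N) /\
  (lambda2 (5 * n)%N = (lambda2^-1) (5 * n)%N) /\
  (forall r : nat, r \in [:: 1; 4]%N ->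
     lambda3 (5 * n + r)%N = - (lambda3^-1) (5 * n + r)%N) /\
  (forall r : nat, r \in [:: 3; 4]%N ->
     lambda4 (5 * n + r)%N = - (lambda4^-1) (5 * n + r - 2)%N) /\
  (forall r : nat, r \in [:: 3; 4]%N ->
     lambda5 (5 * n + r)%N = (lambda5^-1) (5 * n + r - 2)%N) /\
  (forall r : nat, r \in [:: 5; 7]%N ->
     lambda6 (10 * n + r)%N = (lambda6^-1) (10 * n + r - 2)%N) /\
  (forall r : nat, r \in [:: 1; 9]%N ->
     lambda7 (10 * n + r)%N = - (lambda7^-1) (10 * n + r)%N) /\
  (forall r : nat, r \in [:: 5; 9]%N ->
     lambda8 (10 * n + r)%N = - (lambda8^-1) (10 * n + r - 4)%N) /\
  (forall r : nat, r \in [:: 7; 9]%N ->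
     lambda9 (10 * n + r)%N = (lambda9^-1) (10 * n + r - 6)%N) /\
  (forall r : nat, r \in [:: 0; 1]%N ->
     lambda10 (2 * n + r)%N = (-1) ^+ r * (lambda10^-1) (2 * n + r)%N) /\
  (forall r : nat, r \in [:: 2; 3]%N ->
     lambda10 (5 * n + r)%N = (lambda10^-1) (5 * n + r)%N).
Proof.
have in2 (P : nat -> Prop) (a b : nat) : P a -> P b -> forall r, r \in [:: a; b] -> P r.
  by move=> Pa Pb r; rewrite !inE => /orP[]/eqP->.
split; first by apply: in2;
  [apply: (supp_coefD (r := 3) lambda1_supp) | apply: (supp_coefD (r := 4) lambda1_supp)];
  rewrite ?inE; lia.
split.
  have /eqP : (lambda2 - lambda2^-1) (5 * n)%N = 0.
    by apply: (supp_coef0 (r := 0) lambda2_supp); rewrite ?inE; lia.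
  by rewrite fps_coefD fps_coefN subr_eq0 => /eqP.
split.
  move=> r r_in; have /eqP : (lambda3 + lambda3^-1) (5 * n + r)%N = 0.
    by apply: (supp_coef0 (r := r) lambda3_supp); move: r_in; rewrite !inE; lia.
  by rewrite fps_coefD addr_eq0 => /eqP.
split; first by apply: in2;
  [apply: (supp_coefD (r := 3) lambda4_supp) | apply: (supp_coefD (r := 4) lambda4_supp)];
  rewrite ?inE; lia.
split; first by apply: in2;
  [apply: (supp_coefB (r := 3) lambda5_supp) | apply: (supp_coefB (r := 4) lambda5_supp)];
  rewrite ?inE; lia.
split; first by apply: in2;
  [apply: (odd_coefB (r := 0) lambda6_supp) | apply: (odd_coefB (r := 2) lambda6_supp)];
  rewrite ?inE; lia.
(* In (vii) there is no shift: s = 0, and the factor [1] in [lambda7_supp] is read as ['q ^+ 0]. *)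
split; first by apply: in2; rewrite -[(10 * n + _)%N in RHS]subn0;
  [apply: (odd_coefD (s := 0) (r := 1) lambda7_supp) |
   apply: (odd_coefD (s := 0) (r := 4) lambda7_supp)];
  rewrite ?inE; lia.
split; first by apply: in2;
  [apply: (odd_coefD (r := 0) lambda8_supp) | apply: (odd_coefD (r := 4) lambda8_supp)];
  rewrite ?inE; lia.
split; first by apply: in2;
  [apply: (odd_coefB (r := 2) lambda9_supp) | apply: (odd_coefB (r := 4) lambda9_supp)];
  rewrite ?inE; lia.
split.
  move=> r _; have /(congr1 (fun f : fps int => f (2 * n + r)%N)) := lambda10_neg.
  by rewrite neg_coef exprD exprM sqrrN !expr1n mul1r.
move=> r r_in; have /eqP : (lambda10 - lambda10^-1) (5 * n + r)%N = 0.
  by apply: (supp_coef0 (r := r) lambda10_supp); move: r_in; rewrite !inE; lia.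
by rewrite fps_coefD fps_coefN subr_eq0 => /eqP.
Qed.
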